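(* Let $G$ be a finite, simple, connected graph. Then the great shadow $S(G)$ is planar if and only if $G$ is a bipartite cactus graph.
   Context: All graphs are finite, simple and loopless. For a graph $G$ with vertex set $V$, the great shadow $S(G)$ is the graph on $2|V|$ vertices obtained from $G$ by adding, for each vertex $v$ of $G$, a new vertex $v'$ (the shadow vertex of $v$) and making $v'$ adjacent to $v$ and to every neighbor of $v$ in $G$; no other edges are added (in particular, two shadow vertices are never adjacent). A cactus graph is a graph in which no two cycles share an edge (equivalently, every 2-connected component is a cycle). A bipartite cactus is a cactus graph that is bipartite, i.e. all its cycles have even length. *)

(* Defs.v *)
From Stdlib Require Import Reals.
From mathcomp Require Import all_boot.

Set Implicit Arguments.
Unset Strict Implicit.
Unset Printing Implicit Defensive.

Definition simple_graph (T : finType) (e : rel T) : Prop :=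
  symmetric e /\ irreflexive e.

Definition connected_graph (T : finType) (e : rel T) : Prop :=
  forall x y : T, connect e x y.

(* Great shadow S(G): vertices inl v (original) and inr v (shadow v');
   v' is adjacent to v and to every neighbour of v; shadows are pairwise
   non-adjacent. *)
Definition great_shadow (T : finType) (e : rel T) : rel (T + T) :=
  fun a b =>
    match a, b with
    | inl u, inl v => e u v
    | inl u, inr v => (u == v) || e v u
    | inr u, inl v => (u == v) || e u v
    | inr _, inr _ => false
    end.

Definition is_graph_cycle (T : finType) (e : rel T) (c : seq T) : bool :=
  (2 < size c) && ucycleb e c.

Definition cycle_edges (T : finType) (c : seq T) : {set {set T}} :=
  [set [set x; next c x] | x in c].

Definition cactus (T : finType) (e : rel T) : Prop :=
  forall c1 c2 : seq T, is_graph_cycle e c1 -> is_graph_cycle e c2 ->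
    cycle_edges c1 :&: cycle_edges c2 != set0 ->
    cycle_edges c1 = cycle_edges c2.

Definition bipartite (T : finType) (e : rel T) : Prop :=
  exists f : T -> bool, forall x y, e x y -> f x != f y.

(* Planarity: a drawing in R^2. Vertices go to distinct points; every edge
   {u,v} is drawn as an arc (continuous, injective on [0,1]) from pos u to
   pos v whose interior avoids all vertex points; interiors of arcs of
   distinct edges are disjoint. (Continuity is required on all of R, which is
   harmless: any arc on [0,1] extends continuously by constants.) *)
Definition arc (g : R -> R * R) : Prop :=
  (forall t : R, continuity_pt (fun s => fst (g s)) t) /\
  (forall t : R, continuity_pt (fun s => snd (g s)) t) /\
  (forall s t : R, Rle 0 s -> Rle s 1 -> Rle 0 t -> Rle t 1 -> g s = g t -> s = t).

Definition planar (V : finType) (r : rel V) : Prop :=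
  exists (pos : V -> R * R) (curve : V -> V -> R -> R * R),
    injective pos /\
    (forall u v, r u v ->
       arc (curve u v) /\ curve u v R0 = pos u /\ curve u v R1 = pos v /\
       (forall w (t : R), Rlt 0 t -> Rlt t 1 -> curve u v t <> pos w)) /\
    (forall u v u' v', r u v -> r u' v' -> [set u; v] != [set u'; v'] ->
       forall s t : R, Rlt 0 s -> Rlt s 1 -> Rlt 0 t -> Rlt t 1 ->
         curve u v s <> curve u' v' t).

(* Main.v *)
(* Given a drawing of a graph, replace each edge by a polygonal line close enough to
   the edge that vertex-disjoint edges stay disjoint. For disjoint polygonal lines P and
   Q, the number of segments of Q below the ends of P and the number of segments of P
   above the ends of Q have the same parity. Summing these relations over the 18 pairs of
   disjoint edges of K33, every vertical count cancels while the terms that only depend on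
   the order of the vertices add up to 1; hence no subdivision of K33 is planar.

   If G has an odd cycle, S(G) contains a Moebius ladder; if two cycles share an edge, G
   has a theta subgraph with branch vertices x, y, and S(G) contains a subdivision of K33
   with x, x', y' on one side. Conversely, a bipartite cactus is grown from a vertex by
   adding ears (a pendant edge or an even cycle attached at one vertex v). Each ear changes
   S(G) by a gluing along the edge v v', which can be carried out in a two-page book
   embedding. Such an embedding is drawn with arcs of parabolas. *)

From Stdlib Require Import Reals Lra Ring.
From Stdlib Require Import IndefiniteDescription.
From Coquelicot Require Import Compactness.
From mathcomp Require Import all_boot zify.
Require Import Defs.

Set Implicit Arguments.
Unset Strict Implicit.
Unset Printing Implicit Defensive.

Close Scope R_scope.
Delimit Scope R_scope with Re.

(** * Parity of crossings of polygonal lines *)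

Definition point : Type := (R * R)%type.

Definition on_segment (p q z : point) : Prop :=
  exists t : R, (0 <= t <= 1)%Re /\
    z = ((1 - t) * p.1 + t * q.1, (1 - t) * p.2 + t * q.2)%Re.

Definition disjoint_segments (p q p' q' : point) : Prop :=
  forall z, on_segment p q z -> ~ on_segment p' q' z.

(** Breaking ties of abscissas by ordinates acts like an infinitesimal shear of the plane: vertical
    segments and vertices on a common vertical line need no general position argument. *)
Definition lex_pos (u1 u2 : R) : Prop := (0 < u1 \/ u1 = 0 /\ 0 < u2)%Re.

Definition lex (p q : point) : bool :=
  if Rlt_dec p.1 q.1 then true
  else if Req_dec_T p.1 q.1 then (if Rlt_dec p.2 q.2 then true else false)
  else false.

Definition orient (p q r : point) : R :=
  ((q.1 - p.1) * (r.2 - p.2) - (q.2 - p.2) * (r.1 - p.1))%Re.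

Definition left_of (p q v : point) : bool :=
  if Rlt_dec 0 (orient p q v) then true else false.

Definition above (v p q : point) : bool :=
  if lex p q then left_of p q v else left_of q p v.

(* [over v p q]: the segment [pq] lies vertically below [v], where abscissas are
   compared lexicographically. *)
Definition over (v p q : point) : bool := (lex p v (+) lex q v) && above v p q.

Lemma lexP p q : reflect (lex_pos (q.1 - p.1) (q.2 - p.2)) (lex p q).
Proof.
rewrite /lex /lex_pos; case: Rlt_dec => h1; first by constructor; lra.
case: Req_dec_T => h2; last by constructor; lra.
by case: Rlt_dec => h3; constructor; lra.
Qed.

Lemma lex_total p q : p <> q -> lex q p = ~~ lex p q.
Proof.
case: p q => [a b] [c d] neq; apply/lexP/negP => [/= h /lexP /= h'|h].
  rewrite /lex_pos in h h'; lra.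
rewrite /lex_pos /=; case: (Rtotal_order a c) => [?|[?|?]]; last lra.
  by case: h; apply/lexP; rewrite /lex_pos /=; lra.
case: (Rtotal_order b d) => [?|[?|?]]; last lra.
  by case: h; apply/lexP; rewrite /lex_pos /=; lra.
by case: neq; congr pair.
Qed.

Lemma lex_trans q p r : lex p q -> lex q r -> lex p r.
Proof. by move=> /lexP h /lexP h'; apply/lexP; rewrite /lex_pos in h h' *; lra. Qed.

Lemma left_ofP p q v : reflect (0 < orient p q v)%Re (left_of p q v).
Proof. by rewrite /left_of; case: Rlt_dec => h; constructor. Qed.

Lemma on_segmentl p q : on_segment p q p.
Proof. by exists 0%Re; split; [lra | case: p => a b /=; congr pair; ring]. Qed.

Lemma on_segmentr p q : on_segment p q q.
Proof. by exists 1%Re; split; [lra | case: q => a b /=; congr pair; ring]. Qed.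

Lemma on_segmentC p q z : on_segment p q z -> on_segment q p z.
Proof.
move=> [t [ht ->]]; exists (1 - t)%Re; split; first lra.
by congr pair; ring.
Qed.

Lemma disjoint_segmentsC p q p' q' :
  disjoint_segments p q p' q' -> disjoint_segments p' q' p q.
Proof. by move=> h z hz hz'; apply: (h z). Qed.

Lemma disjoint_segmentsCl p q p' q' :
  disjoint_segments p q p' q' -> disjoint_segments q p p' q'.
Proof. by move=> h z /on_segmentC; apply: h. Qed.

Lemma overC v p q : p <> q -> over v p q = over v q p.
Proof.
move=> neq; rewrite /over /above addbC (lex_total neq).
by case: (lex p q).
Qed.

(** Dividing both combinations by the common weight [a + b = c + d] gives one point that is a convex
    combination of either pair of ends. *)
Lemma common_point p p' q r (a b c d : R) :
  (0 <= a)%Re -> (0 <= b)%Re -> (0 <= c)%Re -> (0 <= d)%Re -> (0 < a + b)%Re ->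
  (a + b = c + d)%Re ->
  (a * p.1 + b * p'.1 = c * q.1 + d * r.1)%Re ->
  (a * p.2 + b * p'.2 = c * q.2 + d * r.2)%Re ->
  ~ disjoint_segments p p' q r.
Proof.
move=> a0 b0 c0 d0 ab0 e0 e1 e2 /(_ ((a * p.1 + b * p'.1) / (a + b),
  (a * p.2 + b * p'.2) / (a + b))%Re); case.
  exists (b / (a + b))%Re; split; last by congr pair; field; lra.
  split; first by apply: Rmult_le_pos => //; apply/Rlt_le/Rinv_0_lt_compat.
  by apply: (Rmult_le_reg_r (a + b)) => //; field_simplify; lra.
exists (d / (c + d))%Re; split; last first.
  by rewrite e1 e2 e0; congr pair; field; lra.
split; first by apply: Rmult_le_pos => //; apply/Rlt_le/Rinv_0_lt_compat; lra.
by apply: (Rmult_le_reg_r (c + d)); [lra | field_simplify; lra].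
Qed.

Lemma on_line_segment p q z :
  lex p z -> lex z q -> orient p q z = 0%Re -> on_segment p q z.
Proof.
move=> /lexP h /lexP h' o0; rewrite /lex_pos /orient in h h' o0.
case: (Req_dec p.1 q.1) => e1.
  have e2 : (q.1 = p.1)%Re by [].
  have ez : z.1 = p.1 by lra.
  have lt : (p.2 < q.2)%Re by lra.
  exists ((z.2 - p.2) / (q.2 - p.2))%Re; split.
    split; first by apply: Rmult_le_pos; [lra | apply/Rlt_le/Rinv_0_lt_compat; lra].
    by apply: (Rmult_le_reg_r (q.2 - p.2)); [lra | field_simplify; lra].
  case: z {h h' o0} ez => z1 z2 /= ->; rewrite e2; congr pair; field; lra.
have lt : (p.1 < q.1)%Re by lra.
exists ((z.1 - p.1) / (q.1 - p.1))%Re; split.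
  split; first by apply: Rmult_le_pos; [lra | apply/Rlt_le/Rinv_0_lt_compat; lra].
  by apply: (Rmult_le_reg_r (q.1 - p.1)); [lra | field_simplify; lra].
have e2 : (z.2 - p.2 = (q.2 - p.2) * (z.1 - p.1) / (q.1 - p.1))%Re.
  by apply: (Rmult_eq_reg_l (q.1 - p.1)); [field_simplify; lra | lra].
case: z {h h' o0} e2 => z1 z2 /= e2; congr pair; first by field; lra.
have -> : z2 = (p.2 + (q.2 - p.2) * (z1 - p.1) / (q.1 - p.1))%Re by lra.
by field; lra.
Qed.

Lemma orient_neq0 p q z :
  lex p z -> lex z q -> ~ on_segment p q z -> orient p q z <> 0%Re.
Proof. by move=> h h' nz o0; apply: nz; apply: on_line_segment. Qed.

(** The directions of lexicographically positive vectors fill a half-open half-turn, so the sign of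
    the cross product compares their angles. With [x], [y], [z] the three cross products, z v = y u
    + x w; if z were nonnegative, the left side would be lexicographically nonnegative and the right
    side negative. *)
Lemma cross_trans (u1 u2 v1 v2 w1 w2 : R) :
  lex_pos u1 u2 -> lex_pos v1 v2 -> lex_pos w1 w2 ->
  (u1 * v2 - u2 * v1 < 0)%Re -> (v1 * w2 - v2 * w1 < 0)%Re ->
  (u1 * w2 - u2 * w1 < 0)%Re.
Proof.
set x := (u1 * v2 - _)%Re; set y := (v1 * w2 - _)%Re; set z := (u1 * w2 - _)%Re.
rewrite /lex_pos => hu hv hw hx hy.
have e1 : (z * v1 = y * u1 + x * w1)%Re by rewrite /x /y /z; ring.
have e2 : (z * v2 = y * u2 + x * w2)%Re by rewrite /x /y /z; ring.
clearbody x y z.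
case: (Rlt_le_dec z 0) => // hz.
have u0 : (0 <= u1)%Re by lra.
have v0 : (0 <= v1)%Re by lra.
have w0 : (0 <= w1)%Re by lra.
have u1_0 : u1 = 0%Re by nra.
have w1_0 : w1 = 0%Re by nra.
subst u1 w1; have {}hu : (0 < u2)%Re by lra.
have {}hw : (0 < w2)%Re by lra.
have hz2 : (z * v2 < 0)%Re by nra.
have z_neq0 : z <> 0%Re by move=> z0; rewrite z0 in hz2; lra.
have z0 : (0 < z)%Re by lra.
have {}v0 : v1 = 0%Re by nra.
subst v1; have {}hv : (0 < v2)%Re by lra.
nra.
Qed.

Lemma nested_same_side p p' q r : disjoint_segments p p' q r ->
  lex p q -> lex q r -> lex r p' -> left_of p p' q = left_of p p' r.
Proof.
move=> dis pq qr rp'.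
have half q0 r0 : disjoint_segments p p' q0 r0 ->
    lex p q0 -> lex q0 p' -> lex p r0 -> lex r0 p' ->
    (0 < orient p p' q0)%Re -> (orient p p' r0 < 0)%Re -> False.
  move=> dis0 pq0 q0p pr0 r0p oq orr.
  set a := orient p p' q0; set b := (- orient p p' r0)%Re.
  have [a0 b0] : (0 < a)%Re /\ (0 < b)%Re by rewrite /a /b; lra.
  (* Weighting each end by the orientation of the other makes the affine function [orient p p']
     vanish at [z]. *)
  set z : point := ((b * q0.1 + a * r0.1) / (a + b), (b * q0.2 + a * r0.2) / (a + b))%Re.
  have oz : orient p p' z = 0%Re.
    by rewrite /orient /z /= ; apply: (Rmult_eq_reg_l (a + b)); [field_simplify; [rewrite /a /b /orient; ring|lra]| lra].
  have i0 : (0 < / (a + b))%Re by apply: Rinv_0_lt_compat; lra.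
  have zi : (0 < a / (a + b) /\ 0 < b / (a + b) /\ a / (a + b) + b / (a + b) = 1)%Re.
    by split; [apply: Rmult_lt_0_compat|split; [apply: Rmult_lt_0_compat|field; lra]].
  have z1 : z.1 = (b / (a + b) * q0.1 + a / (a + b) * r0.1)%Re by rewrite /z /=; field; lra.
  have z2 : z.2 = (b / (a + b) * q0.2 + a / (a + b) * r0.2)%Re by rewrite /z /=; field; lra.
  have dE : (b / (a + b) = 1 - a / (a + b))%Re by lra.
  have comb (c d x1 y1 x2 y2 : R) : (0 < c)%Re -> (0 < d)%Re -> lex_pos x1 y1 -> lex_pos x2 y2 ->
      lex_pos (d * x1 + c * x2) (d * y1 + c * y2).
    by rewrite /lex_pos => ? ? [?|[-> ?]] [?|[-> ?]]; [left|left|left|right]; split || idtac; nra.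
  have pz : lex p z.
    apply/lexP; move/lexP: pq0 => pq0; move/lexP: pr0 => pr0.
    have := comb _ _ _ _ _ _ zi.1 zi.2.1 pq0 pr0; congr lex_pos; rewrite ?z1 ?z2 !dE; ring.
  have zp : lex z p'.
    apply/lexP; move/lexP: q0p => q0p; move/lexP: r0p => r0p.
    have := comb _ _ _ _ _ _ zi.1 zi.2.1 q0p r0p; congr lex_pos; rewrite ?z1 ?z2 !dE; ring.
  apply: (dis0 z); first exact: on_line_segment.
  exists (a / (a + b))%Re; split; first by lra.
  by rewrite {1}(surjective_pairing z) z1 z2 !dE; congr pair; ring.
have qp' := lex_trans qr rp'; have pr := lex_trans pq qr.
have oq : orient p p' q <> 0%Re.
  by apply: orient_neq0 => // h; apply: (dis q) => //; apply: on_segmentl.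
have or : orient p p' r <> 0%Re.
  by apply: orient_neq0 => // h; apply: (dis r) => //; apply: on_segmentr.
apply/left_ofP/left_ofP => h; apply: Rnot_le_lt => h'.
  by apply: (half q r) => //; lra.
apply: (half r q) => //; last lra.
by move=> z hz /on_segmentC; apply: dis.
Qed.

(** Over the common range of abscissas, from [q] to [p'], one segment stays above the other; the two
    sides read at [q] and at [p'] are therefore opposite. *)
Lemma interleaved_side p p' q r : disjoint_segments p p' q r ->
  lex p q -> lex q p' -> lex p' r -> left_of q r p' = ~~ left_of p p' q.
Proof.
move=> dis pq qp' p'r.
have pp' := lex_trans pq qp'; have qr := lex_trans qp' p'r.
have oq : orient p p' q <> 0%Re.
  by apply: orient_neq0 => // h; apply: (dis q) => //; apply: on_segmentl.
have op : orient q r p' <> 0%Re.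
  by apply: orient_neq0 => // h; apply: (dis p') => //; apply: on_segmentr.
have pr := lex_trans pq qr.
move/lexP in pq; move/lexP in qp'; move/lexP in p'r; move/lexP in pr.
move/lexP in pp'; move/lexP in qr.
apply/left_ofP/idP => [h|/left_ofP h].
  apply/left_ofP => h'.
  have d0 : (orient p q r < 0)%Re.
    have := cross_trans pq qp' qr; rewrite /orient in h h' *; nra.
  have g0 : (orient p p' r < 0)%Re.
    have := cross_trans pp' qp' p'r; rewrite /orient in h h' *; nra.
  (* These weights give the intersection of the two lines: each end is weighted by the area that the
     other end of its segment spans with the other segment. [cross_trans] provided the two signs
     that were not assumed. *)
  apply: (@common_point p p' q r (- orient q p' r) (- orient p q r) (- orient p p' r) (- orient p q p')) dis;
    rewrite /orient in h h' d0 g0 *; nra.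
apply: Rnot_le_lt => h'.
have h1 : (orient p p' q < 0)%Re by lra.
have h2 : (orient q r p' < 0)%Re by lra.
have d0 : (0 < orient p q r)%Re.
  have := @cross_trans _ _ _ _ _ _ qr qp' pq; rewrite /orient in h1 h2 *; nra.
have g0 : (0 < orient p p' r)%Re.
  have := @cross_trans _ _ _ _ _ _ p'r qp' pp'; rewrite /orient in h1 h2 *; nra.
by apply: (@common_point p p' q r (orient q p' r) (orient p q r) (orient p p' r) (orient p q p')) dis;
  rewrite /orient in h1 h2 d0 g0 *; nra.
Qed.

(** For segments, [lt p q (+) lt p' q] tells whether the vertical line through [q] meets [p p'];
    adding [ov q p p'] leaves the case where [p p'] is above [q]. The rule is stated for arbitrary
    [lt] and [ov] because it serves first for segments, then for whole edges, where [ov] is a parity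
    of counts. *)
Definition parity_rule (X : Type) (lt : X -> X -> bool) (ov : X -> X -> X -> bool)
    (p p' q q' : X) : Prop :=
  ov p q q' (+) ov p' q q' =
  (lt p q (+) lt p' q (+) ov q p p') (+) (lt p q' (+) lt p' q' (+) ov q' p p').

Lemma lex_antisym p q : lex p q -> lex q p = false.
Proof.
by move=> /lexP h; apply/lexP => h'; rewrite /lex_pos in h h'; lra.
Qed.

Lemma disjoint_neq p q p' q' : disjoint_segments p q p' q' ->
  [/\ p' <> p, p' <> q, q' <> p & q' <> q].
Proof.
by move=> dis; split=> e; [apply: (dis p) | apply: (dis q) | apply: (dis p) | apply: (dis q)];
   rewrite -?e; do ?[exact: on_segmentl | exact: on_segmentr].
Qed.

Lemma lex_irrefl p : lex p p = false.
Proof. by apply/negP => h; move: (lex_antisym h); rewrite h. Qed.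

Lemma over_nil v p : over v p p = false.
Proof. by rewrite /over addbb. Qed.

Lemma lex_cases p q : p = q \/ lex p q \/ lex q p.
Proof.
have [->|h] : p = q \/ p <> q by apply: Classical_Prop.classic.
  by left.
by right; rewrite (lex_total h); case: (lex p q); [left|right].
Qed.

(** The rule is invariant under exchange of the two segments and reversal of either one. This leaves
    segments directed to the right, the first one starting first: their ranges of abscissas are then
    disjoint, nested or interleaved. *)
Lemma over_disjoint p p' q q' : disjoint_segments p p' q q' ->
  parity_rule lex over p p' q q'.
Proof.
have main a a' b b' : disjoint_segments a a' b b' -> lex a a' -> lex b b' ->
    lex a b -> parity_rule lex over a a' b b'.
  move=> dis aa bb ab; rewrite /parity_rule /over /above aa bb.
  have ab' := lex_trans ab bb.
  rewrite ab ab' !(lex_antisym ab) !(lex_antisym ab') /=.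
  have [_ neq1 _ neq2] := disjoint_neq dis.
  have [//|[h|h]] := lex_cases b a'; last first.
    have h' := lex_trans h bb.
    by rewrite h h' (lex_antisym h) (lex_antisym h').
  have [//|[h'|h']] := lex_cases b' a'; rewrite h h' (lex_antisym h) (lex_antisym h') /=.
    by rewrite (nested_same_side dis ab bb h') addbb.
  by rewrite (interleaved_side dis ab h h') ?addbF ?addTb ?addFb ?addbT.
have sym a a' b b' : disjoint_segments a a' b b' ->
    parity_rule lex over b b' a a' -> parity_rule lex over a a' b b'.
  rewrite /parity_rule => dis.
  have [n1 n2 n3 n4] := disjoint_neq dis.
  rewrite (lex_total n1) (lex_total n2) (lex_total n3) (lex_total n4).
  by case: (lex b a); case: (lex b a'); case: (lex b' a); case: (lex b' a');
     case: (over a b b'); case: (over a' b b'); case: (over b a a'); case: (over b' a a').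
have main2 a a' b b' : disjoint_segments a a' b b' -> lex a a' -> lex b b' ->
    parity_rule lex over a a' b b'.
  move=> dis aa bb; have [e|[ab|ba]] := lex_cases a b.
  - by have [neq _ _ _] := disjoint_neq dis; case: neq.
  - exact: main.
  - by apply: sym => //; apply: main => //; apply: disjoint_segmentsC.
have flip a a' b b' : a <> a' -> parity_rule lex over a' a b b' -> parity_rule lex over a a' b b'.
  rewrite /parity_rule => neq; rewrite !(overC _ neq) addbC => ->.
  by rewrite (addbC (lex a b)) (addbC (lex a b')).
have main3 a a' b b' : disjoint_segments a a' b b' -> lex b b' ->
    parity_rule lex over a a' b b'.
  move=> dis bb; have [->|[aa|aa]] := lex_cases a a'.
  - by rewrite /parity_rule !over_nil !addbb.
  - exact: main2.
  - apply: flip; first by move=> e; move: aa; rewrite e lex_irrefl.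
    by apply: main2 => //; apply: disjoint_segmentsCl.
move=> dis; have [e|[h|h]] := lex_cases q q'.
- by subst q'; rewrite /parity_rule !over_nil !addbb.
- exact: main3.
- have dis' := disjoint_segmentsCl (disjoint_segmentsC dis).
  apply: (sym _ _ _ _ dis); apply: flip; first by move=> e; move: h; rewrite e lex_irrefl.
  by apply: (sym _ _ _ _ dis'); apply: main3 => //; apply: disjoint_segmentsC.
Qed.

(** * Summation along walks, and the parity contradiction for K33 *)

Definition walk_over (X : Type) (ov : X -> X -> X -> bool) (v : X) (f : nat -> X) (n : nat) :=
  \big[addb/false]_(i < n) ov v (f i) (f i.+1).

Lemma addb_telescope (F : nat -> bool) n :
  \big[addb/false]_(i < n) (F i (+) F i.+1) = F 0 (+) F n.
Proof.
elim: n => [|n IH]; first by rewrite big_ord0 addbb.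
by rewrite big_ord_recr /= IH addbA addbK.
Qed.

(** The rule is summed over all pairs of steps. The order terms telescope along [f], the values of
    [ov] at the vertices of [f] telescope likewise, and the remaining terms telescope along [g]. *)
Lemma parity_rule_walk (X : Type) (lt : X -> X -> bool) (ov : X -> X -> X -> bool)
    (f g : nat -> X) n m :
  (forall i j, i < n -> j < m -> parity_rule lt ov (f i) (f i.+1) (g j) (g j.+1)) ->
  walk_over ov (f 0) g m (+) walk_over ov (f n) g m =
  (lt (f 0) (g 0) (+) lt (f n) (g 0) (+) walk_over ov (g 0) f n) (+)
  (lt (f 0) (g m) (+) lt (f n) (g m) (+) walk_over ov (g m) f n).
Proof.
move=> rule.
have under v : \big[addb/false]_(i < n) (lt (f i) v (+) lt (f i.+1) v (+) ov v (f i) (f i.+1)) =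
    lt (f 0) v (+) lt (f n) v (+) walk_over ov v f n.
  by rewrite big_split /= (addb_telescope (fun i => lt (f i) v)).
rewrite -!under -(addb_telescope (fun j => \big[addb/false]_(i < n) _)) -big_split /=.
apply: eq_bigr => j _.
rewrite -(addb_telescope (fun i => ov (f i) (g j) (g j.+1))) -big_split /=.
by apply: eq_bigr => i _; apply: rule.
Qed.

(** The tactic [ring] knows the booleans as a ring whose addition is [xorb]. *)
Lemma addb_xorb a b : a (+) b = xorb a b.
Proof. by case: a; case: b. Qed.

Lemma K33_parity (X : eqType) (lt : X -> X -> bool) (ov : X -> X -> X -> bool)
    (a b : nat -> X) (P : nat -> nat -> nat -> X) (len : nat -> nat -> nat) :
  (forall x y, x != y -> lt y x = ~~ lt x y) ->
  b 0 != b 1 -> b 0 != b 2 -> b 1 != b 2 ->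
  (forall i j, i < 3 -> j < 3 -> P i j 0 = a i /\ P i j (len i j) = b j) ->
  ~ (forall i k j l, i < k -> k < 3 -> j < 3 -> l < 3 -> j != l ->
     forall s t, s < len i j -> t < len k l ->
     parity_rule lt ov (P i j s) (P i j s.+1) (P k l t) (P k l t.+1)).
Proof.
move=> anti b01 b02 b12 ends rule.
pose W v i j := walk_over ov v (P i j) (len i j).
have eqn i k j l (ik : i < k) (k3 : k < 3) (j3 : j < 3) (l3 : l < 3) (jl : j != l) :
    xorb (xorb (xorb (W (a i) k l) (W (b j) k l))
     (xorb (xorb (lt (a i) (a k)) (lt (b j) (a k))) (W (a k) i j)))
     (xorb (xorb (lt (a i) (b l)) (lt (b j) (b l))) (W (b l) i j)) = false.
  have i3 : i < 3 by apply: (@ltn_trans k).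
  have [e1 e2] := ends i j i3 j3; have [e3 e4] := ends k l k3 l3.
  have := parity_rule_walk (fun s t hs ht => rule i k j l ik k3 j3 l3 jl s t hs ht).
  by rewrite e1 e2 e3 e4 -!/(W _ _ _) -!addb_xorb => ->; rewrite -addbA addbb.
have e10 := anti _ _ b01; have e20 := anti _ _ b02; have e21 := anti _ _ b12.
have h1 := eqn 0 1 0 1 isT isT isT isT isT; have h2 := eqn 0 1 0 2 isT isT isT isT isT.
have h3 := eqn 0 1 1 0 isT isT isT isT isT; have h4 := eqn 0 1 1 2 isT isT isT isT isT.
have h5 := eqn 0 1 2 0 isT isT isT isT isT; have h6 := eqn 0 1 2 1 isT isT isT isT isT.
have k1 := eqn 0 2 0 1 isT isT isT isT isT; have k2 := eqn 0 2 0 2 isT isT isT isT isT.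
have k3 := eqn 0 2 1 0 isT isT isT isT isT; have k4 := eqn 0 2 1 2 isT isT isT isT isT.
have k5 := eqn 0 2 2 0 isT isT isT isT isT; have k6 := eqn 0 2 2 1 isT isT isT isT isT.
have l1 := eqn 1 2 0 1 isT isT isT isT isT; have l2 := eqn 1 2 0 2 isT isT isT isT isT.
have l3 := eqn 1 2 1 0 isT isT isT isT isT; have l4 := eqn 1 2 1 2 isT isT isT isT isT.
have l5 := eqn 1 2 2 0 isT isT isT isT isT; have l6 := eqn 1 2 2 1 isT isT isT isT isT.
have add2 x y : x = false -> y = false -> xorb x y = false by move=> -> ->.
have := add2 _ _ (add2 _ _ (add2 _ _ (add2 _ _ h1 h2) (add2 _ _ h3 h4)) (add2 _ _ (add2 _ _ h5 h6) (add2 _ _ k1 k2)))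
 (add2 _ _ (add2 _ _ (add2 _ _ (add2 _ _ k3 k4) (add2 _ _ k5 k6)) (add2 _ _ (add2 _ _ l1 l2) (add2 _ _ l3 l4))) (add2 _ _ l5 l6)).
(* Only the six terms [lt (b j) (b l)] occur an odd number of times, namely three. The two orders of
   a pair add up to 1, so the three pairs contribute 9, which is [true]. *)
rewrite e10 e20 e21 -!(Bool.xorb_true_l (lt _ _)).
match goal with |- ?E = false -> _ => have -> : E = true by ring end.
by [].
Qed.

(** * Polygonal approximation of a drawing *)

Lemma continuity_pt_near (h : R -> R) (u eps : R) : continuity_pt h u -> (0 < eps)%Re ->
  exists d : R, (0 < d)%Re /\ forall x, (Rabs (x - u) < d)%Re -> (Rabs (h x - h u) < eps)%Re.
Proof.
move=> cont eps0; have [d [d0 hd]] := cont eps eps0.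
exists d; split=> // x xu.
have [->|neq] := Req_dec u x; first by rewrite Rminus_diag Rabs_R0.
exact: (hd x).
Qed.

Definition near (eps : R) (c p : point) : Prop :=
  (Rabs (p.1 - c.1) < eps /\ Rabs (p.2 - c.2) < eps)%Re.

Lemma near_segment eps c p q z :
  near eps c p -> near eps c q -> on_segment p q z -> near eps c z.
Proof.
move=> [/Rabs_def2 h1 /Rabs_def2 h2] [/Rabs_def2 h3 /Rabs_def2 h4] [t [ht ->]].
have lerp a b : (0 < a -> 0 < b -> 0 < (1 - t) * a + t * b)%Re.
  by move=> a0 b0; case: (Rle_lt_dec t (1 / 2)) => ?; nra.
have up (a b e : R) : (a < e -> b < e -> (1 - t) * a + t * b < e)%Re.
  by move=> h h'; have := lerp (e - a)%Re (e - b)%Re; lra.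
have lo (a b e : R) : (e < a -> e < b -> e < (1 - t) * a + t * b)%Re.
  by move=> h h'; have := lerp (a - e)%Re (b - e)%Re; lra.
split; apply: Rabs_def1 => /=.
- by have := up p.1 q.1 (eps + c.1)%Re; lra.
- by have := lo p.1 q.1 (c.1 - eps)%Re; lra.
- by have := up p.2 q.2 (eps + c.2)%Re; lra.
- by have := lo p.2 q.2 (c.2 - eps)%Re; lra.
Qed.

Lemma near_disjoint (p q : point) : p <> q ->
  exists eps, (0 < eps)%Re /\ forall z, near eps p z -> ~ near eps q z.
Proof.
move=> neq; exists (Rmax (Rabs (p.1 - q.1)) (Rabs (p.2 - q.2)) / 2)%Re; split.
  apply: Rmult_lt_0_compat; last lra.
  have [e1|n1] := Req_dec p.1 q.1; last first.
    by apply: (Rlt_le_trans _ _ _ _ (Rmax_l _ _)); apply: Rabs_pos_lt; lra.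
  have [e2|n2] := Req_dec p.2 q.2; last first.
    by apply: (Rlt_le_trans _ _ _ _ (Rmax_r _ _)); apply: Rabs_pos_lt; lra.
  by case: neq; rewrite (surjective_pairing p) e1 e2 -surjective_pairing.
move=> z [/Rabs_def2 h1 /Rabs_def2 h2] [/Rabs_def2 h3 /Rabs_def2 h4]; move: h1 h2 h3 h4.
by rewrite /Rmax; case: Rle_dec => _; rewrite /Rabs; case: Rcase_abs; lra.
Qed.

(** Around each [(u, v)] of the unit square, the curves stay in disjoint convex squares about [f u]
    and [g v]. Compactness bounds these gauges below by a uniform [d], and steps shorter than [d]
    suffice. *)
Lemma sampled_disjoint (f g : R -> point) :
  (forall t, continuity_pt (fun s => (f s).1) t) ->
  (forall t, continuity_pt (fun s => (f s).2) t) ->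
  (forall t, continuity_pt (fun s => (g s).1) t) ->
  (forall t, continuity_pt (fun s => (g s).2) t) ->
  (forall s t, (0 <= s <= 1)%Re -> (0 <= t <= 1)%Re -> f s <> g t) ->
  exists N0 : nat, forall N : nat, N0 < N -> forall i j : nat, i < N -> j < N ->
    disjoint_segments (f (INR i / INR N)%Re) (f (INR i.+1 / INR N)%Re)
                      (g (INR j / INR N)%Re) (g (INR j.+1 / INR N)%Re).
Proof.
move=> cf1 cf2 cg1 cg2 fg.
(* The factor 2 leaves room for the next sample: the first is within the gauge of the chosen point,
   the next one less than [d] further. *)
have gauge (uv : R * R) : exists d : posreal, (0 <= uv.1 <= 1)%Re -> (0 <= uv.2 <= 1)%Re ->
    forall x x' y y', (Rabs (x - uv.1) < 2 * d)%Re -> (Rabs (x' - uv.1) < 2 * d)%Re ->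
      (Rabs (y - uv.2) < 2 * d)%Re -> (Rabs (y' - uv.2) < 2 * d)%Re ->
    disjoint_segments (f x) (f x') (g y) (g y').
  case: uv => u v /=.
  have [] := Classical_Prop.classic ((0 <= u <= 1)%Re /\ (0 <= v <= 1)%Re); last first.
    by move=> h; exists posreal_one => hu hv; case: h.
  move=> [hu hv]; have [eps [eps0 sep]] := near_disjoint (fg u v hu hv).
  have [d1 [d1_0 h1]] := continuity_pt_near (cf1 u) eps0.
  have [d2 [d2_0 h2]] := continuity_pt_near (cf2 u) eps0.
  have [d3 [d3_0 h3]] := continuity_pt_near (cg1 v) eps0.
  have [d4 [d4_0 h4]] := continuity_pt_near (cg2 v) eps0.
  pose m := Rmin (Rmin d1 d2) (Rmin d3 d4).
  have m0 : (0 < m)%Re by do !apply: Rmin_glb_lt.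
  have m1 : (m <= d1)%Re by apply: (Rle_trans _ _ _ (Rmin_l _ _) (Rmin_l _ _)).
  have m2 : (m <= d2)%Re by apply: (Rle_trans _ _ _ (Rmin_l _ _) (Rmin_r _ _)).
  have m3 : (m <= d3)%Re by apply: (Rle_trans _ _ _ (Rmin_r _ _) (Rmin_l _ _)).
  have m4 : (m <= d4)%Re by apply: (Rle_trans _ _ _ (Rmin_r _ _) (Rmin_r _ _)).
  have half : (0 < m / 2)%Re by lra.
  exists (mkposreal _ half) => _ _ x x' y y' /= hx hx' hy hy' z hz hz'.
  apply: (sep z); [apply: (near_segment _ _ hz)|apply: (near_segment _ _ hz')];
    by split; [apply: h1 || apply: h3|apply: h2 || apply: h4]; lra.
have [delta hdelta] := functional_choice _ gauge.
have [d hd] := compactness_value_2d 0 1 0 1 (fun u v => delta (u, v)).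
have [N0 [hN0 N0pos]] := archimed_cor1 d (cond_pos d).
exists N0 => N leN i j iN jN.
have N0' : (0 < INR N)%Re by apply: lt_0_INR; apply/ltP; apply: leq_ltn_trans leN.
have unit k : k <= N -> (0 <= INR k / INR N <= 1)%Re.
  move=> kN; split; first by apply: Rmult_le_pos; [apply: pos_INR|apply/Rlt_le/Rinv_0_lt_compat].
  apply: (Rmult_le_reg_r (INR N)) => //; field_simplify; last lra.
  by apply: le_INR; apply/leP.
have close k u dl : (Rabs (INR k / INR N - u) < dl)%Re -> (d <= dl)%Re ->
    (Rabs (INR k.+1 / INR N - u) < 2 * dl)%Re.
  move=> hk ddl.
  have -> : (INR k.+1 / INR N - u = (INR k / INR N - u) + / INR N)%Re.
    by rewrite S_INR; field; lra.
  apply: (Rle_lt_trans _ _ _ (Rabs_triang _ _)).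
  have : (/ INR N <= / INR N0)%Re.
    apply: Rinv_le_contravar; first by apply: lt_0_INR.
    by apply: le_INR; apply/leP; apply: ltnW.
  rewrite (Rabs_pos_eq (/ INR N)); last by apply/Rlt_le/Rinv_0_lt_compat.
  by lra.
(* [compactness_value_2d] provides the chosen point under a double negation only. *)
apply: Classical_Prop.NNPP => nd.
apply: (hd (INR i / INR N)%Re (INR j / INR N)%Re); do ?by apply: unit; apply: ltnW.
move=> [u [v [hu [hv [h1 [h2 h3]]]]]]; apply: nd.
apply: (hdelta (u, v)) => //=; do ?exact: close; have := cond_pos (delta (u, v)); lra.
Qed.

Lemma fin_eventually (I : finType) (Q : I -> nat -> Prop) :
  (forall i, exists N0, forall N, N0 < N -> Q i N) ->
  exists N, 0 < N /\ forall i, Q i N.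
Proof.
move=> /fin_all_exists [N0 hN0]; exists (\max_i N0 i).+1; split=> // i.
by apply: hN0; rewrite ltnS leq_bigmax.
Qed.

(** This is all that is retained of a drawing. Every edge is sampled at the same number [N] of
    steps, and [ov w u v] is the parity of the number of segments of the polygonal edge [u v] below
    [w]. *)
Lemma planar_parity (V : finType) (r : rel V) : planar r ->
  exists (lt : rel V) (ov : V -> V -> V -> bool),
    (forall x y, x != y -> lt y x = ~~ lt x y) /\
    forall u v u' v', r u v -> r u' v' -> u != u' -> u != v' -> v != u' -> v != v' ->
      parity_rule lt ov u v u' v'.
Proof.
move=> [pos [curve [inj [ends cross]]]].
have [N [N0 sep]] : exists N, 0 < N /\ forall q : (V * V) * (V * V),
    r q.1.1 q.1.2 -> r q.2.1 q.2.2 ->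
    q.1.1 != q.2.1 -> q.1.1 != q.2.2 -> q.1.2 != q.2.1 -> q.1.2 != q.2.2 ->
    forall i j : nat, i < N -> j < N ->
    disjoint_segments (curve q.1.1 q.1.2 (INR i / INR N)%Re) (curve q.1.1 q.1.2 (INR i.+1 / INR N)%Re)
     (curve q.2.1 q.2.2 (INR j / INR N)%Re) (curve q.2.1 q.2.2 (INR j.+1 / INR N)%Re).
  apply: (@fin_eventually _ (fun q N => r q.1.1 q.1.2 -> r q.2.1 q.2.2 ->
    q.1.1 != q.2.1 -> q.1.1 != q.2.2 -> q.1.2 != q.2.1 -> q.1.2 != q.2.2 ->
    forall i j : nat, i < N -> j < N ->
    disjoint_segments (curve q.1.1 q.1.2 (INR i / INR N)%Re) (curve q.1.1 q.1.2 (INR i.+1 / INR N)%Re)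
     (curve q.2.1 q.2.2 (INR j / INR N)%Re) (curve q.2.1 q.2.2 (INR j.+1 / INR N)%Re))).
  move=> [[u v] [u' v']] /=.
  have [/and5P[ruv ruv' d1 d2 /andP[d3 d4]]|nall] :=
    boolP [&& r u v, r u' v', u != u', u != v' & (v != u') && (v != v')]; last first.
    by exists 0 => N _ h1 h2 h3 h4 h5 h6; move: nall; rewrite h1 h2 h3 h4 h5 h6.
  have [[c1 [c2 _]] [c_0 [c_1 cw]]] := ends u v ruv.
  have [[c1' [c2' _]] [c_0' [c_1' cw']]] := ends u' v' ruv'.
  have [] := @sampled_disjoint (curve u v) (curve u' v') => //; last first.
    by move=> N0 hN0; exists N0 => N hN *; apply: hN0.
  have edges_neq : [set u; v] != [set u'; v'].
    apply/eqP => /setP /(_ u); rewrite !inE eqxx /= => /esym.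
    by rewrite (negbTE d1) (negbTE d2).
  have mem01 (s : R) : (0 <= s <= 1)%Re -> s = 0%Re \/ s = 1%Re \/ (0 < s < 1)%Re by lra.
  move=> s t /mem01 [->|[->|s01]] /mem01 [->|[->|t01]].
  - by rewrite c_0 c_0' => /inj /eqP; apply/negP.
  - by rewrite c_0 c_1' => /inj /eqP; apply/negP.
  - by rewrite c_0 => /esym; apply: cw'; lra.
  - by rewrite c_1 c_0' => /inj /eqP; apply/negP.
  - by rewrite c_1 c_1' => /inj /eqP; apply/negP.
  - by rewrite c_1 => /esym; apply: cw'; lra.
  - by rewrite c_0'; apply: cw; lra.
  - by rewrite c_1'; apply: cw; lra.
  - by apply: cross => //; lra.
exists (fun u v => lex (pos u) (pos v)).
exists (fun w u v => walk_over over (pos w) (fun i => curve u v (INR i / INR N)%Re) N).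
split=> [x y /eqP xy|u v u' v' ruv ruv' d1 d2 d3 d4].
  by apply: lex_total => /inj.
have NR : INR N <> 0%Re by apply: not_0_INR => N_0; rewrite N_0 in N0.
have start a b : r a b -> curve a b (INR 0 / INR N)%Re = pos a.
  by move=> rab; have [_ [<- _]] := ends a b rab; congr curve; rewrite /Rdiv Rmult_0_l.
have stop a b : r a b -> curve a b (INR N / INR N)%Re = pos b.
  by move=> rab; have [_ [_ [<- _]]] := ends a b rab; congr curve; field.
have := @parity_rule_walk _ lex over (fun i => curve u v (INR i / INR N)%Re)
  (fun i => curve u' v' (INR i / INR N)%Re) N N.
rewrite !start // !stop //; apply => i j iN jN.
by apply: over_disjoint; apply: (sep ((u, v), (u', v'))).
Qed.

(** * Nonplanar great shadows *)

(** Disjointness is required only of paths that differ at both ends, as in the parity argument.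
    Paths issued from one branch vertex may overlap. *)
Lemma K33_nonplanar (V : finType) (r : rel V) (a b : nat -> V)
    (P : nat -> nat -> nat -> V) (len : nat -> nat -> nat) :
  b 0 != b 1 -> b 0 != b 2 -> b 1 != b 2 ->
  (forall i j, i < 3 -> j < 3 -> P i j 0 = a i /\ P i j (len i j) = b j) ->
  (forall i j s, i < 3 -> j < 3 -> s < len i j -> r (P i j s) (P i j s.+1)) ->
  (forall i k j l s t, i < k -> k < 3 -> j < 3 -> l < 3 -> j != l ->
     s <= len i j -> t <= len k l -> P i j s != P k l t) ->
  ~ planar r.
Proof.
move=> b01 b02 b12 ends edges disj /planar_parity [lt [ov [anti rule]]].
apply: (@K33_parity V lt ov a b P len) => // i k j l ik k3 j3 l3 jl s t hs ht.
have i3 := ltn_trans ik k3.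
by apply: rule; do ?[exact: edges | by apply: disj => //; apply: ltnW].
Qed.

Lemma great_shadow_sym (T : finType) (e : rel T) :
  symmetric e -> symmetric (great_shadow e).
Proof. by move=> sym [u|u] [v|v] //=; rewrite ?(eq_sym u) // sym. Qed.

(* The [i]-th path leaves [x] through [g i 0]; its last vertex [g i (n i)] is [y]
   itself when the path has length one, and a neighbour of [y] otherwise. Then
   [x], [x'] and [y'] are linked to the three vertices [g i 0]. *)
Lemma theta_nonplanar (T : finType) (e : rel T) (x y : T)
    (g : nat -> nat -> T) (n : nat -> nat) :
  symmetric e -> x != y ->
  (forall i, i < 3 -> e x (g i 0)) ->
  (forall i s, i < 3 -> s < n i -> e (g i s) (g i s.+1)) ->
  (forall i, i < 3 -> (g i (n i) == y) || e (g i (n i)) y) ->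
  (forall i s, i < 3 -> s <= n i -> g i s != x) ->
  (forall i k s t, i < k -> k < 3 -> s <= n i -> t <= n k -> g i s != g k t) ->
  ~ planar (great_shadow e).
Proof.
move=> sym xy first_e path_e last_e avoid disj.
pose hub (j : nat) : T + T :=
  if j == 0 then inl x else if j == 1 then inr x else inr y.
(* Single edges lead from [g i 0] to [x] and [x']. The path to [y'] follows [g i] to its end, which
   is [y] or a neighbour of [y], hence adjacent to [y']. *)
pose m i j := if j == 2 then n i else 0.
have hub_neq j l : j < 3 -> l < 3 -> j != l -> hub j != hub l.
  by move: j l => [|[|[|//]]] [|[|[|//]]] //= _ _ _; rewrite /hub /=;
    apply/eqP => -[] // /eqP; rewrite ?(negbTE xy) // eq_sym (negbTE xy).
have m_le i j s : s <= m i j -> s <= n i.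
  by rewrite /m; case: ifP => // _; rewrite leqn0 => /eqP ->.
have inl_hub i j s : i < 3 -> s <= n i -> inl (g i s) != hub j :> T + T.
  move=> i3 hs; rewrite /hub; case: ifP => [_|_]; last by case: ifP.
  by apply/eqP => -[] /eqP; apply/negP; apply: avoid.
apply: (@K33_nonplanar _ _ (fun i => inl (g i 0)) hub
  (fun i j s => if s <= m i j then inl (g i s) else hub j) (fun i j => (m i j).+1));
  try exact: hub_neq.
- by move=> i j i3 j3; rewrite ltnn.
- move=> i j s i3 j3; rewrite ltnS => sm; rewrite sm.
  case: ltnP => [sm'|ms]; first by rewrite /= path_e // (leq_trans sm') // (m_le i j).
  have {ms} -> : s = m i j by apply/eqP; rewrite eqn_leq sm.
  move: j j3 {sm} => [|[|[|//]]] _; rewrite /m /hub /=.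
  + by rewrite sym first_e.
  + by rewrite first_e ?orbT.
  + by rewrite (sym y) last_e.
- move=> i k j l s t ik k3 j3 l3 jl _ _; have i3 := ltn_trans ik k3.
  
  case: (leqP s (m i j)) => [/(m_le i j s) hs|_]; case: (leqP t (m k l)) => [/(m_le k l t) ht|_].
  + by apply: contraNneq (disj _ _ _ _ ik k3 hs ht) => -[->].
  + exact: inl_hub.
  + by rewrite eq_sym; apply: inl_hub.
  + exact: hub_neq.
Qed.

(** A cycle as an [n]-periodic sequence: rotation becomes a shift of the index, and the closing edge
    is an edge like the others. *)
Definition cycle_fun (T : eqType) (e : rel T) (n : nat) (v : nat -> T) : Prop :=
  [/\ 2 < n, forall i, e (v i) (v i.+1) & forall i j, (v i == v j) = (i == j %[mod n])].

Lemma cycle_fun_shift (T : eqType) (e : rel T) n v k :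
  cycle_fun e n v -> cycle_fun e n (fun i => v (k + i)).
Proof.
move=> [n2 ev vP]; split=> // [i|i j]; first by rewrite addnS.
by rewrite vP eqn_modDl.
Qed.

(* The vertices [v 0, v 1 ', v 2, v 3 ', ...] form a closed walk of length [2n]
   whose antipodal vertices are some [v i] and its shadow: a Moebius ladder. *)
Lemma odd_cycle_nonplanar (T : finType) (e : rel T) n v :
  symmetric e -> cycle_fun e n v -> odd n -> ~ planar (great_shadow e).
Proof.
move=> sym [n2 ev vP] n_odd.
pose w j : T + T := if odd j then inr (v j) else inl (v j).
have gsym := great_shadow_sym sym.
have w_next j : great_shadow e (w j) (w j.+1).
  rewrite /w /=; case: (odd j) => /=; first by rewrite ev orbT.
  by rewrite sym ev orbT.
have w_anti j : great_shadow e (w j) (w (j + n)).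
  have vn : v j == v (j + n) by rewrite vP modnDr.
  by rewrite /w oddD n_odd addbT; case: (odd j) => /=; rewrite vn.
have w_per : w (2 * n) = w 0.
  by rewrite /w mul2n odd_double /=; congr inl; apply/eqP; rewrite vP -muln2 modnMr mod0n.
(* Equality makes [k - j] a multiple of [n], and even because the two vertices are of the same kind;
   as [n] is odd, [2 * n] divides [k - j]. *)
have w_eq j k : j <= k -> k <= 2 * n -> w j = w k -> j = k \/ j = 0 /\ k = 2 * n.
  move=> jk k2n; have par : w j = w k -> v j == v k /\ odd j = odd k.
    by rewrite /w; case: (odd j); case: (odd k) => // -[->].
  move=> /par; rewrite vP eq_sym eqn_mod_dvd // => -[/dvdnP [q kj] pjk].
  have : odd (k - j) = false by rewrite oddB // pjk addbb.
  rewrite kj oddM n_odd andbT => q_even.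
  have q2 : q <= 2 by nia.
  by move: q q2 q_even kj => [|[|[|//]]] // _ _ kj; lia.
have w_neq j k : j <= 2 * n -> k <= 2 * n -> j != k -> j != 0 \/ k != 2 * n ->
    j != 2 * n \/ k != 0 -> w j != w k.
  move=> j2 k2 jk h1 h2; apply/eqP => wjk.
  have [le|/ltnW le] := leqP j k; first by have := w_eq _ _ le k2 wjk; lia.
  by have := w_eq _ _ le j2 (esym wjk); lia.
clearbody w.
(* The branch vertices are the ends of three consecutive rungs, at 0, 1, 2, n, n+1, n+2, alternately
   on the two sides. Seven of the paths are single edges; the other two run from 2 up to n and from
   2n, which is 0 again, down to n+2. *)
pose a i := if i == 0 then 0 else if i == 1 then 2 else n.+1.
pose b j := if j == 0 then 1 else if j == 1 then n else n.+2.
pose long i j := [|| (i == 0) && (j == 2) | (i == 1) && (j == 1)].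
pose I i j s :=
  if (i == 0) && (j == 2) then 2 * n - s else if (i == 1) && (j == 1) then 2 + s
  else if s == 0 then a i else b j.
apply: (@K33_nonplanar _ _ (w \o a) (w \o b) (fun i j s => w (I i j s))
  (fun i j => if long i j then n - 2 else 1)); try by apply: w_neq; rewrite /b /=; lia.
- move=> [|[|[|//]]] [|[|[|//]]] _ _; rewrite /I /a /b /long /=; split=> //; rewrite ?subn0 //;
  by congr w; lia.
- move=> [|[|[|//]]] [|[|[|//]]] s _ _; rewrite /I /a /b /long /= => hs;
    try (have -> : s = 0 by lia); rewrite /=.
  + exact: w_next.
  + exact: (w_anti 0).
  + by rewrite gsym; have -> : 2 * n - s = (2 * n - s.+1).+1 by lia.
  + by rewrite gsym; apply: w_next.
  + by rewrite addnS; apply: w_next.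
  + by have := w_anti 2; rewrite addSn addSn.
  + by rewrite gsym; have := w_anti 1; rewrite add1n.
  + by rewrite gsym; apply: w_next.
  + exact: w_next.
- move=> i k j l s t ik k3 j3 l3 jl; have i3 := ltn_trans ik k3.
  rewrite /long => hs ht; apply: w_neq; move: i k j l ik k3 j3 l3 jl i3 hs ht => [|[|[|//]]] [|[|[|//]]] //
    [|[|[|//]]] [|[|[|//]]] // _ _ _ _ _ _; rewrite /I /a /b /=; case: s => [|s]; case: t => [|t] /=; lia.
Qed.

(** * Odd cycles, and cycles that share an edge *)

Section CycleFun.
Variables (T : finType) (e : rel T).

Definition cyc_nth (x0 : T) (c : seq T) (i : nat) : T := nth x0 c (i %% size c).

Lemma next_cyc_nth x0 c i : uniq c -> 0 < size c ->
  next c (cyc_nth x0 c i) = cyc_nth x0 c i.+1.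
Proof.
move=> c_uniq c0; rewrite /cyc_nth.
have im : i %% size c < size c by rewrite ltn_mod.
rewrite next_nth mem_nth // index_uniq //.
have -> : i.+1 %% size c = (i %% size c).+1 %% size c by rewrite -[in RHS]addn1 modnDml addn1.
move: (i %% size c) im => k {i}.
case: c c_uniq c0 => [//|y c] _ _ /=.
rewrite ltnS leq_eqVlt => /orP [/eqP ->|lt]; first by rewrite modnn nth_default.
by rewrite modn_small //=; apply: set_nth_default.
Qed.

Lemma cycle_fun_cyc_nth x0 c : is_graph_cycle e c ->
  cycle_fun e (size c) (cyc_nth x0 c).
Proof.
move=> /andP [c2 /andP [cyc c_uniq]]; have c0 : 0 < size c by apply: ltn_trans c2.
split=> // [i|i j].
  by rewrite -next_cyc_nth // (next_cycle cyc) // mem_nth // ltn_mod.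
by rewrite /cyc_nth nth_uniq // ltn_mod.
Qed.

Lemma mem_cyc_nth x0 c x : 0 < size c -> (x \in c) <-> exists i, x = cyc_nth x0 c i.
Proof.
move=> c0; split=> [|[i ->]]; last by rewrite mem_nth // ltn_mod.
by move=> /(nthP x0) [i ic <-]; exists i; rewrite /cyc_nth modn_small.
Qed.

Lemma cycle_edges_cyc_nth x0 c E : uniq c -> 0 < size c ->
  (E \in cycle_edges c) <-> exists i, E = [set cyc_nth x0 c i; cyc_nth x0 c i.+1].
Proof.
move=> c_uniq c0; split=> [/imsetP [x xc ->]|[i ->]].
  have /(mem_cyc_nth x0 _ c0) [i ->] := xc; exists i.
  by rewrite next_cyc_nth.
apply/imsetP; exists (cyc_nth x0 c i); first by rewrite mem_nth // ltn_mod.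
by rewrite next_cyc_nth.
Qed.

Hypotheses (sym : symmetric e) (irr : irreflexive e).

Lemma not_uniq_split (S : eqType) (c : seq S) : ~~ uniq c ->
  exists x s0 s1 s2, c = s0 ++ x :: s1 ++ x :: s2.
Proof.
elim: c => //= x c IH; rewrite negb_and negbK => /orP [xc|/IH].
  by have [s1 s2] := splitPr xc; exists x, [::], s1, s2.
by move=> [y [s0 [s1 [s2 ->]]]]; exists y, (x :: s0), s1, s2.
Qed.

(** A repeated vertex cuts the walk into two shorter closed walks, one of them odd. A walk without
    repetition has size at least 3, since size 1 would be a loop. *)
Lemma odd_closed_walk c : cycle e c -> odd (size c) ->
  exists c', is_graph_cycle e c' /\ odd (size c').
Proof.
have [n] := ubnP (size c); elim: n c => // n IH c cn cyc c_odd.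
have [c_uniq|/not_uniq_split [x [s0 [s1 [s2 cE]]]]] := boolP (uniq c).
  exists c; split=> //; rewrite /is_graph_cycle /ucycleb cyc c_uniq !andbT.
  by case: c cyc c_odd {cn c_uniq} => [|x [|y [|z c]]] //=; rewrite irr.
have : cycle e ((x :: s1 ++ x :: s2) ++ s0) by rewrite -rot_size_cat rot_cycle -cE.
rewrite /= -catA /= rcons_cat cat_path /= => /and3P [p1 e1 p2].
have sz : size c = size (x :: s1) + size (x :: s2 ++ s0).
  by rewrite cE /= !size_cat /= !size_cat /=; lia.
have [odd1|even1] := boolP (odd (size (x :: s1))).
  by apply: IH odd1; [rewrite sz /= in cn *; lia | rewrite /= rcons_path p1].
apply: (IH (x :: s2 ++ s0)); [by rewrite sz /= in cn *; lia | exact: p2 |].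
by move: c_odd; rewrite sz oddD (negbTE even1).
Qed.

(** Colour each vertex by the parity of a chosen path from [x0]. An edge between equal colours
    closes the two paths into an odd walk. *)
Lemma nonbipartite_odd_cycle : connected_graph e -> ~ bipartite e ->
  exists c, is_graph_cycle e c /\ odd (size c).
Proof.
move=> conn nbip; apply: Classical_Prop.NNPP => no_odd; apply: nbip.
have [x0|T0] := pickP (mem T); last by exists (fun=> true) => x; have := T0 x.
move=> _; have /fin_all_exists [p hp] x : exists p, path e x0 p /\ last x0 p = x.
  by have /connectP [p] := conn x0 x; exists p.
exists (fun x => odd (size (p x))) => x y exy; apply/negP => /eqP par; apply: no_odd.
have [px lx] := hp x; have [py ly] := hp y.
apply: (@odd_closed_walk (x0 :: p x ++ rev (p y))); last first.
  by rewrite /= size_cat size_rev oddD par addbb.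
rewrite /= rcons_cat -rev_cons cat_path px lx lastI rev_rcons ly /= exy /=.
by have := rev_path e x0 (p y); rewrite ly => ->; rewrite (eq_path (e' := e)) // => u w; rewrite sym.
Qed.

Lemma cycle_fun_index n v k i : cycle_fun e n v -> exists2 j, j < n & v (k + j) = v i.
Proof.
move=> [n2 _ vP]; have n0 := ltnW (ltnW n2).
exists ((i + (n - k %% n)) %% n); first by rewrite ltn_mod.
apply/eqP; rewrite vP modnDmr addnCA.
have -> : k + (n - k %% n) = (k %/ n).+1 * n.
  by have := divn_eq k n; have := ltn_pmod k n0; nia.
by rewrite addnC modnMDl.
Qed.

Lemma cycle_fun_succ n v i j : cycle_fun e n v -> v i = v j -> v i.+1 = v j.+1.
Proof.
move=> [_ _ vP] /eqP; rewrite vP => /eqP ij.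
by apply/eqP; rewrite vP -addn1 -(addn1 j) -modnDml ij modnDml.
Qed.

(** The two arcs of the cycle and the path [h] form a theta with branch vertices [w 0] and [w b].
    When [h] has no inner vertex, the last hypothesis makes it a genuine chord. *)
Lemma cycle_chord_nonplanar n w b d (h : nat -> T) :
  cycle_fun e n w -> 0 < b -> b < n ->
  h 0 = w 0 -> h d.+1 = w b -> (forall i, i <= d -> e (h i) (h i.+1)) ->
  (forall s i, 0 < s -> s <= d -> h s != w i) ->
  (d = 0 -> b != 1 /\ b.+1 != n) ->
  ~ planar (great_shadow e).
Proof.
move=> [n2 ew wP] b0 bn h0 hd eh h_out chord.
have w_per : w n = w 0 by apply/eqP; rewrite wP modnn mod0n.
have w_neq i j : i < n -> j < n -> i != j -> w i != w j.
  by move=> hi hj; rewrite wP !modn_small.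
pose g i s := if i == 0 then w s.+1 else if i == 1 then w (n - s.+1) else h s.+1.
(* The index 0 is the vertex after [w 0], and [m i] is that of the vertex before [w b]. For a path
   of one edge the truncated subtraction gives 0, and [g i 0] is [w b] itself, as [theta_nonplanar]
   allows. *)
pose m i := if i == 0 then b - 2 else if i == 1 then n - b - 2 else d - 1.
have g2_neq s i : s <= d - 1 -> i < n -> (i != b) || (0 < d) -> h s.+1 != w i.
  move=> sd hi; have [d0 ib|d0 _] := posnP d; last by apply: h_out; lia.
  have -> : s = d by lia.
  by rewrite hd w_neq // eq_sym; move: ib; rewrite orbF.
apply: (@theta_nonplanar T e (w 0) (w b) g m) => //.
- by apply: w_neq; lia.
- move=> [|[|[|//]]] _; rewrite /g /=; [exact: ew | | by rewrite -h0; apply: eh].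
  by have := ew (n - 1); rewrite subn1 (prednK (ltnW (ltnW n2))) w_per sym.
- move=> [|[|[|//]]] s _; rewrite /g /m /= => hs //; last by apply: eh; lia.
  have -> : n - s.+1 = (n - s.+2).+1 by lia.
  by rewrite sym.
- move=> [|[|[|//]]] _; rewrite /g /m /=.
  + have [->|b1] := eqVneq b 1; first by rewrite eqxx.
    by apply/orP; right; rewrite {2}(_ : b = (b - 2).+2) //; lia.
  + have [b1|b1] := eqVneq b n.-1.
      by apply/orP; left; rewrite b1; apply/eqP; congr w; lia.
    by apply/orP; right; rewrite sym (_ : n - _ = b.+1) //; lia.
  + have [d0|d0] := posnP d; first by rewrite -hd d0 eqxx.
    by apply/orP; right; rewrite -hd (_ : (d - 1).+1 = d) ?eh //; lia.
- move=> [|[|[|//]]] s _; rewrite /g /m /= => hs; [apply: w_neq|apply: w_neq|apply: g2_neq]; lia.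
- move=> [|[|[|?]]] [|[|[|?]]] s t //= _ _; rewrite /g /m /= => hs ht.
  + by apply: w_neq; lia.
  + rewrite eq_sym; apply: g2_neq; [lia|lia|].
    by have [/chord [/eqP b1 _]|] := posnP d; rewrite ?orbT // orbF; lia.
  + rewrite eq_sym; apply: g2_neq; [lia|lia|].
    by have [/chord [_ /eqP b1]|] := posnP d; rewrite ?orbT // orbF; lia.
Qed.

(** Follow [c2] from a shared edge to its first edge outside [c1], then on to the first return to
    [c1]: this stretch is the third path of a theta. *)
Lemma shared_edge_theta c1 c2 :
  is_graph_cycle e c1 -> is_graph_cycle e c2 ->
  cycle_edges c1 :&: cycle_edges c2 != set0 ->
  ~~ (cycle_edges c2 \subset cycle_edges c1) ->
  ~ planar (great_shadow e).
Proof.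
move=> g1 g2 /set0Pn [E /setIP [E1 E2]] /subsetPn [F F2 F1].
have := g1; have := g2; move=> /andP [c2_2 /andP [_ u2]] /andP [c1_2 /andP [_ u1]].
have c1_0 := ltnW (ltnW c1_2); have c2_0 := ltnW (ltnW c2_2).
have x0 : T by case: c1 c1_0 {g1 E1 F1 c1_2 u1}.
have f1 := cycle_fun_cyc_nth x0 g1; have f2 := cycle_fun_cyc_nth x0 g2.
have edge1 := fun E => cycle_edges_cyc_nth x0 E u1 c1_0.
have mem1 := fun x => mem_cyc_nth x0 x c1_0.
have /(cycle_edges_cyc_nth x0 _ u2 c2_0) [i2 E2'] := E2.
have {}f2 := cycle_fun_shift i2 f2.
have [k kn Fk] : exists2 k, k < size c2 &
    F = [set cyc_nth x0 c2 (i2 + k); cyc_nth x0 c2 (i2 + k).+1].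
  have /(cycle_edges_cyc_nth x0 _ u2 c2_0) [j ->] := F2.
  have [k kn kj] := cycle_fun_index i2 j (cycle_fun_cyc_nth x0 g2).
  by exists k; rewrite // (cycle_fun_succ (cycle_fun_cyc_nth x0 g2) kj) kj.
set n1 := size c1 in f1 *; set n2 := size c2 in f2 kn *.
set v := cyc_nth x0 c1 in f1 edge1 mem1 *.
set u := (fun i => cyc_nth x0 c2 (i2 + i)) in f2.
have {}E2' : E = [set u 0; u 1] by rewrite E2' /u addn0 addn1.
have {}Fk : F = [set u k; u k.+1] by rewrite Fk /u addnS.
clearbody u v n1 n2.
have edge_mem i : [set u i; u i.+1] \in cycle_edges c1 -> (u i \in c1) && (u i.+1 \in c1).
  move=> /edge1 [j /setP eqE]; apply/andP.
  have h z : z \in [set v j; v j.+1] -> z \in c1.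
    by rewrite !inE => /orP [] /eqP ->; apply/mem1; [exists j | exists j.+1].
  by split; apply: h; rewrite -eqE !inE eqxx ?orbT.
have exP : exists k, [set u k; u k.+1] \notin cycle_edges c1 by exists k; rewrite -Fk.
case: (ex_minnP exP) => k0 Pk0 k0_min {exP}.
have k0n : k0 < n2 by apply: leq_ltn_trans kn; apply: k0_min; rewrite -Fk.
have k0_0 : 0 < k0 by rewrite lt0n; apply: contraNneq Pk0 => ->; rewrite -E2'.
have xc1 : u k0 \in c1.
  have := @edge_mem k0.-1; rewrite prednK // => h.
  suff /h /andP [] : [set u k0.-1; u k0] \in cycle_edges c1 by [].
  apply: contraT => h'; have := k0_min k0.-1; rewrite prednK // => /(_ h').
  by rewrite leqNgt ltn_predL k0_0.
have [n2_2 eu uP] := f2.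
have u_per : u n2 = u 0 by apply/eqP; rewrite uP modnn mod0n.
have u0c1 : u 0 \in c1 by have := @edge_mem 0; rewrite -E2' => /(_ E1) /andP [].
have mE : k0 + (n2 - k0.+1).+1 = n2 by rewrite addnS -addSn subnKC.
move: (n2 - k0.+1) mE => m mE.
(* The return takes place at [u n2 = u 0] at the latest, before [c2] is back at [u k0]; hence the
   ends of the stretch differ. *)
have exQ : exists d, u (k0 + d.+1) \in c1 by exists m; rewrite mE u_per.
case: (ex_minnP exQ) => d yc1 d_min {exQ}.
have dm : d <= m by apply: d_min; rewrite mE u_per.
have xy : u k0 != u (k0 + d.+1).
  rewrite uP -{1}(addn0 k0) eqn_modDl mod0n modn_small //.
  by rewrite -mE addnS ltnS; apply: (leq_ltn_trans dm); rewrite -{1}(add0n m) ltn_add2r.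
have /mem1 [i0 xE] := xc1; have /mem1 [i1 yE] := yc1.
have [b bn vb] := cycle_fun_index i0 i1 f1.
have wc1 i : v i \in c1 by apply/mem1; exists i.
have wedge i : [set v (i0 + i); v (i0 + i.+1)] \in cycle_edges c1.
  by apply/edge1; exists (i0 + i); rewrite addnS.
have b0 : 0 < b.
  by rewrite lt0n; apply: contraNneq xy => b0; rewrite xE yE -vb b0 addn0.
have v_per : v (i0 + n1) = v i0.
  by have [_ _ vP] := f1; apply/eqP; rewrite vP modnDr.
apply: (@cycle_chord_nonplanar n1 (fun i => v (i0 + i)) b d (fun i => u (k0 + i))) => //.
- exact: cycle_fun_shift.
- by rewrite !addn0.
- by rewrite yE vb.
- by move=> i _; rewrite addnS.
- move=> [|s] i // _ sd; apply/negP => /eqP us.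
  have : u (k0 + s.+1) \in c1 by rewrite us.
  by move=> /d_min; rewrite leqNgt sd.
- move=> d0; rewrite d0 addn1 in yE; split; apply: contraNneq Pk0 => bE.
    by rewrite yE -vb xE bE -{1}(addn0 i0); apply: wedge.
  by rewrite yE -vb xE setUC -v_per -bE; apply: wedge.
Qed.

Lemma planar_cactus : planar (great_shadow e) -> cactus e.
Proof.
move=> pl c1 c2 g1 g2 meet; apply/eqP; rewrite eqEsubset.
apply/andP; split; apply: contraT => nsub; exfalso.
  by apply: (shared_edge_theta g2 g1) pl; rewrite // setIC.
exact: (shared_edge_theta g1 g2) pl.
Qed.

Lemma planar_bipartite : connected_graph e -> planar (great_shadow e) -> bipartite e.
Proof.
move=> conn pl; apply: Classical_Prop.NNPP => /(nonbipartite_odd_cycle conn) [c [gc c_odd]].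
have [x0 _] : exists x : T, true by case: c gc c_odd => // x c _ _; exists x.
exact: (odd_cycle_nonplanar sym (cycle_fun_cyc_nth x0 gc) c_odd).
Qed.
End CycleFun.

(** * Two-page book embeddings *)

(* A book embedding with two pages: the vertices are placed on a line, and two edges
   on the same page do not interleave. *)
Definition two_page (V : Type) (r : rel V) (pos : V -> nat) (pg : rel V) : Prop :=
  symmetric pg /\
  forall a b c d, r a b -> r c d -> pos a < pos c -> pos c < pos b -> pos b < pos d ->
    pg a b != pg c d.

(** If one interval strictly contains the other, both factors are at least as large for it and one
    is larger, so the parabolas do not meet above an inner point. *)
Lemma parabola_meet (a b c d x : R) : (a < x < b)%Re -> (c < x < d)%Re ->
  ((x - a) * (b - x) = (x - c) * (d - x))%Re ->
  (a = c /\ b = d) \/ (a < c /\ c < b /\ b < d)%Re \/ (c < a /\ a < d /\ d < b)%Re.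
Proof.
move=> xab xcd eq; case: (Rtotal_order a c) => [ac|[ac|ca]].
- by case: (Rlt_le_dec b d) => bd; [lra | nra].
- by subst c; left; split=> //; nra.
- by case: (Rlt_le_dec d b) => bd; [lra | nra].
Qed.

(** With x = a + t (b - a), the height is (x - a)(b - x) up to sign; all these parabolas have the
    same leading coefficient up to sign. *)
Definition parabola_arc (a b : R) (up : bool) (t : R) : point :=
  (a + t * (b - a), (if up then 1 else -1) * (t * (1 - t) * ((b - a) * (b - a))))%Re.

Lemma parabola_arc_rev a b up t : parabola_arc a b up t = parabola_arc b a up (1 - t)%Re.
Proof. by rewrite /parabola_arc; congr pair; ring. Qed.

Lemma arc_parabola a b up : a <> b -> arc (parabola_arc a b up).
Proof.
move=> ab; split; [|split].
- by move=> t; rewrite /parabola_arc /=; reg.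
- by move=> t; rewrite /parabola_arc /=; reg.
- move=> s t _ _ _ _ [est _].
  have : ((s - t) * (b - a) = 0)%Re by lra.
  by move=> /Rmult_integral [|]; lra.
Qed.

Lemma parabola_arc_meet a b c d up up' s t :
  (a < b)%Re -> (c < d)%Re -> (0 < s < 1)%Re -> (0 < t < 1)%Re ->
  parabola_arc a b up s = parabola_arc c d up' t ->
  up = up' /\ ((a = c /\ b = d) \/ (a < c /\ c < b /\ b < d)%Re \/ (c < a /\ a < d /\ d < b)%Re).
Proof.
move=> ab cd hs ht [ex ey].
have ps : (0 < s * (1 - s) * ((b - a) * (b - a)))%Re.
  by do !apply: Rmult_lt_0_compat; lra.
have pt : (0 < t * (1 - t) * ((d - c) * (d - c)))%Re.
  by do !apply: Rmult_lt_0_compat; lra.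
have up_eq : up = up' by case: up up' ey => -[] //; lra.
split=> //; subst up'.
have {}ey : (s * (1 - s) * ((b - a) * (b - a)) = t * (1 - t) * ((d - c) * (d - c)))%Re.
  by case: up ey => ey; lra.
apply: (@parabola_meet _ _ _ _ (a + s * (b - a))%Re).
- by split; nra.
- by rewrite ex; split; nra.
- by rewrite {3 4}ex; nra.
Qed.

Lemma two_page_planar (V : finType) (r : rel V) (pos : V -> nat) (pg : rel V) :
  irreflexive r -> symmetric r -> injective pos -> two_page r pos pg -> planar r.
Proof.
move=> irr sym inj [pg_sym cross].
pose p v := INR (pos v).
have p_inj u v : p u = p v -> u = v by move=> /INR_eq /inj.
exists (fun v => (p v, 0%Re)), (fun u v => parabola_arc (p u) (p v) (pg u v)).
split; first by move=> u v [] /p_inj.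
have neq u v : r u v -> p u <> p v by move=> ruv /p_inj e; rewrite e irr in ruv.
split=> [u v ruv|].
  split; first by apply: arc_parabola; apply: neq.
  rewrite /parabola_arc; do 2!(split; first by congr pair; ring).
  move=> w t t0 t1 [_].
  have : (0 < t * (1 - t) * ((p v - p u) * (p v - p u)))%Re.
    have := neq _ _ ruv => ?; apply: Rmult_lt_0_compat; first by nra.
    by have [?|[?|?]] := Rtotal_order (p u) (p v); [nra | lra | nra].
  by case: (pg u v); lra.
have lt_p u v : (p u < p v)%Re -> pos u < pos v by move=> /INR_lt /ltP.
have main u v u' v' s t : r u v -> r u' v' -> [set u; v] != [set u'; v'] ->
    (p u < p v)%Re -> (p u' < p v')%Re -> (0 < s < 1)%Re -> (0 < t < 1)%Re ->
    parabola_arc (p u) (p v) (pg u v) s <> parabola_arc (p u') (p v') (pg u' v') t.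
  move=> ruv ruv' dif uv uv' hs ht /(parabola_arc_meet uv uv' hs ht).
  move=> [same [[/p_inj e1 /p_inj e2]|[[/lt_p h1 [/lt_p h2 /lt_p h3]]|[/lt_p h1 [/lt_p h2 /lt_p h3]]]]].
  - by rewrite e1 e2 eqxx in dif.
  - by have := cross _ _ _ _ ruv ruv' h1 h2 h3; rewrite same eqxx.
  - by have := cross _ _ _ _ ruv' ruv h1 h2 h3; rewrite same eqxx.
have main2 u v u' v' s t : r u v -> r u' v' -> [set u; v] != [set u'; v'] ->
    (p u < p v)%Re -> (0 < s < 1)%Re -> (0 < t < 1)%Re ->
    parabola_arc (p u) (p v) (pg u v) s <> parabola_arc (p u') (p v') (pg u' v') t.
  move=> ruv ruv' dif uv hs ht; have [lt|[e|lt]] := Rtotal_order (p u') (p v').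
  - exact: main.
  - by case: (neq _ _ ruv').
  - rewrite (parabola_arc_rev (p u')) (pg_sym u'); apply: main => //; last lra.
      by rewrite sym.
    by rewrite (setUC [set v']).
move=> u v u' v' ruv ruv' dif s t s0 s1 t0 t1.
have [lt|[e|lt]] := Rtotal_order (p u) (p v).
- exact: main2.
- by case: (neq _ _ ruv).
- rewrite (parabola_arc_rev (p u)) (pg_sym u); apply: main2 => //; try lra.
    by rewrite sym.
  by rewrite (setUC [set v]).
Qed.

Definition base (T : Type) (a : T + T) : T := match a with inl x => x | inr x => x end.

(* The last clause says that, for [{l, h} = {v, v'}], no other edge leaves [l] below the
   arc [l h]: a vertex inserted just after [l] can be joined to [h] along that arc. *)
Definition layout (T : finType) (e : rel T) (A : {set T})
    (pos : T + T -> nat) (pg : rel (T + T)) : Prop :=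
  let r a b := [&& great_shadow e a b, base a \in A & base b \in A] in
  [/\ two_page r pos pg,
      forall a b, base a \in A -> base b \in A -> pos a = pos b -> a = b &
      forall l h d, base l = base h -> r l d -> base h \in A ->
        pos l < pos d -> pos d < pos h -> pg l d != pg l h].

(* Slots of the new vertices [q_0, ..., q_(m-1)] of an ear attached at [v], in the
   order q_0, q_0', q_(m-1)', q_(m-2), q_(m-2)', ..., q_1, q_1', q_(m-1): those adjacent
   to [v'] can be reached from both pages, those adjacent to [v] from the lower one. *)
Definition slot_orig (m i : nat) : nat :=
  if i == 0 then 1 else if i == m.-1 then m.*2 else (m - i).*2.
Definition slot_shadow (m i : nat) : nat := if i == 0 then 2 else (m - i).*2.+1.

(** Edges leaving slots 1 and 2 may pass over slots 2 and 3, which [v] reaches from below, so they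
    are upper. Longer edges into slot 2m are lower. The edges from slot 2k to 2k+2 and 2k+3
    interleave with those from 2k+2, so their pages alternate with k. The edge from 3 to 4 is upper
    for the last clause of [layout], as 3 and 2m hold a vertex and its shadow. *)
Definition upper (m lo hi : nat) : bool :=
  [|| lo <= 2, (lo == 3) && (hi == 4) | (hi < m.*2) && (lo %% 4 == 0)].

(** A purely arithmetical list that covers the slots of all edges inside the ear: neighbouring
    slots, edges at q_0 or q_0', edges into q_(m-1), and the remaining edges between consecutive
    vertices. *)
Definition gadget_edge (m lo hi : nat) : Prop :=
  [\/ hi = lo.+1,
      [/\ 3 <= m, 0 < lo & [\/ lo <= 2 /\ hi = m.*2 - 2 | lo = 1 /\ hi = m.*2.-1]],
      [/\ 3 <= m, hi = m.*2 & 3 <= lo <= 5] |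
      [/\ ~~ odd lo, 4 <= lo, hi < m.*2 & hi = lo.+2 \/ hi = lo.+3]].

Lemma gadget_edge_oo m i : odd m -> i.+1 < m ->
  gadget_edge m (minn (slot_orig m i) (slot_orig m i.+1)) (maxn (slot_orig m i) (slot_orig m i.+1)).
Proof.
move=> m_odd im; have m3 : 3 <= m by lia.
have [i0|i0] := eqVneq i 0.
  by rewrite i0 /slot_orig /= ifN; [apply: Or42; split|]; lia.
have im1 : (i == m.-1) = false by lia.
rewrite /slot_orig (negbTE i0) im1 /=.
by case: ifP => im2; [apply: Or43 | apply: Or44]; split; lia.
Qed.

Lemma gadget_edge_os m i : odd m -> i.+1 < m ->
  gadget_edge m (minn (slot_orig m i) (slot_shadow m i.+1)) (maxn (slot_orig m i) (slot_shadow m i.+1)).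
Proof.
move=> m_odd im; have m3 : 3 <= m by lia.
have [i0|i0] := eqVneq i 0.
  by rewrite i0 /slot_orig /slot_shadow /=; apply: Or42; split; lia.
have im1 : (i == m.-1) = false by lia.
by rewrite /slot_orig /slot_shadow (negbTE i0) im1 /=; apply: Or41; lia.
Qed.

Lemma gadget_edge_so m i : odd m -> i.+1 < m ->
  gadget_edge m (minn (slot_shadow m i) (slot_orig m i.+1)) (maxn (slot_shadow m i) (slot_orig m i.+1)).
Proof.
move=> m_odd im; have m3 : 3 <= m by lia.
have [i0|i0] := eqVneq i 0.
  by rewrite i0 /slot_orig /slot_shadow /= ifN; [apply: Or42; split|]; lia.
rewrite /slot_orig /slot_shadow (negbTE i0) /=.
by case: ifP => im2; [apply: Or43 | apply: Or44]; split; lia.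
Qed.

Lemma gadget_edge_pair m i : odd m -> i < m ->
  gadget_edge m (minn (slot_orig m i) (slot_shadow m i)) (maxn (slot_orig m i) (slot_shadow m i)).
Proof.
move=> m_odd im; have [i0|i0] := eqVneq i 0.
  by rewrite i0 /slot_orig /slot_shadow /=; apply: Or41.
rewrite /slot_orig /slot_shadow (negbTE i0) /=.
by case: ifP => im2; [apply: Or43; split | apply: Or41]; lia.
Qed.

Lemma gadget_edge_cross m a b c d : odd m -> gadget_edge m a b -> gadget_edge m c d ->
  a < c -> c < b -> b < d -> upper m a b != upper m c d.
Proof.
rewrite /upper => m_odd e1 e2 ac cb bd.
case: e1 => [|[? ? [[]|[]]]|[]|[? ? ? []]]; case: e2 => [|[? ? [[]|[]]]|[]|[? ? ? []]]; lia.
Qed.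

(** * Gluing the shadow of an ear into a layout *)

Section Extend.
Variables (T : finType) (e : rel T) (A : {set T}) (pos : T + T -> nat) (pg : rel (T + T)).
Variables (v : T) (q : seq T).
Hypothesis sym : symmetric e.
Hypotheses (lay : layout e A pos pg) (vA : v \in A).
Hypotheses (q_uniq : uniq q) (q_odd : odd (size q)) (q_out : forall y, y \in q -> y \notin A).
Hypothesis attach : forall x y, x \in A -> y \in q -> e x y ->
  x = v /\ (index y q = 0 \/ index y q = (size q).-1).
Hypothesis consecutive : forall x y, x \in q -> y \in q -> e x y ->
  index y q = (index x q).+1 \/ index x q = (index y q).+1.

Let m := size q.
Let tau (a : T + T) : nat := match a with
  | inl x => slot_orig m (index x q) | inr x => slot_shadow m (index x q) end.
(** Multiplying the old positions by [K] frees 2m positions just after [l] for the slots. *)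
Let K := m.*2.+1.
Let l : T + T := if pos (inl v) < pos (inr v) then inl v else inr v.
Let h : T + T := if pos (inl v) < pos (inr v) then inr v else inl v.
Let new (a : T + T) : bool := base a \in q.
Let pos' (a : T + T) : nat := if new a then K * pos l + tau a else K * pos a.
Let up (a b : T + T) : bool := upper m (minn (tau a) (tau b)) (maxn (tau a) (tau b)).
(** Edges from the ear to [h] run along the arc of [l h], on its page; those to [l] take the other
    page. *)
Let pg_end (b : T + T) : bool := if b == h then pg l h else ~~ pg l h.
Let pg' (a b : T + T) : bool :=
  if new a then if new b then up a b (+) pg_end (inl v) else pg_end b
  else if new b then pg_end a else pg a b.
Let B := A :|: [set x in q].

Lemma slot_bounds a : new a -> 0 < tau a < K.
Proof.
rewrite /new /tau /K /m -index_mem; case: a => x /=; move: (index x q) => i.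
  by rewrite /slot_orig; case: ifP => ?; [|case: ifP]; lia.
by rewrite /slot_shadow; case: ifP => ?; lia.
Qed.

Lemma pos'_lt a b : (pos' a < pos' b) =
  if new a then if new b then tau a < tau b else pos l < pos b
  else if new b then pos a <= pos l else pos a < pos b.
Proof.
rewrite /pos'; case: (boolP (new a)) => na; case: (boolP (new b)) => nb.
- by rewrite ltn_add2l.
- have /andP [t0 tK] := slot_bounds na.
  by apply/idP/idP => lt; nia.
- have /andP [t0 tK] := slot_bounds nb.
  by apply/idP/idP => lt; nia.
- by rewrite ltn_pmul2l.
Qed.

Lemma tau_inj a b : new a -> new b -> tau a = tau b -> a = b.
Proof.
have idx x y : x \in q -> y \in q -> index x q = index y q -> x = y.
  by move=> xq yq /(congr1 (nth x q)); rewrite !nth_index.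
rewrite /new /tau; case: a b => [x|x] [y|y] /= xq yq eq.
- congr inl; apply: idx => //; move: eq xq yq; rewrite -!index_mem -/m /slot_orig.
  by do !case: eqP; lia.
- exfalso; move: eq xq yq; rewrite -!index_mem -/m /slot_orig /slot_shadow.
  by do !case: eqP; lia.
- exfalso; move: eq xq yq; rewrite -!index_mem -/m /slot_orig /slot_shadow.
  by do !case: eqP; lia.
- congr inr; apply: idx => //; move: eq xq yq; rewrite -!index_mem -/m /slot_shadow.
  by do !case: eqP; lia.
Qed.

Lemma gadget_edge_new a b : new a -> new b -> great_shadow e a b ->
  gadget_edge m (minn (tau a) (tau b)) (maxn (tau a) (tau b)).
Proof.
rewrite /new /tau; case: a b => [x|x] [y|y] //= xq yq.
- by move=> /(consecutive xq yq) [] eq;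
    [|rewrite minnC maxnC]; rewrite eq; apply: gadget_edge_oo; rewrite -?eq ?index_mem.
- move=> /orP [/eqP <-|]; first by apply: gadget_edge_pair; rewrite ?index_mem.
  move=> /(consecutive yq xq) [] eq; rewrite eq.
    by rewrite minnC maxnC; apply: gadget_edge_so; rewrite -?eq ?index_mem.
  by apply: gadget_edge_os; rewrite -?eq ?index_mem.
- move=> /orP [/eqP <-|]; first by rewrite minnC maxnC; apply: gadget_edge_pair; rewrite ?index_mem.
  move=> /(consecutive xq yq) [] eq; rewrite eq.
    by apply: gadget_edge_so; rewrite -?eq ?index_mem.
  by rewrite minnC maxnC; apply: gadget_edge_os; rewrite -?eq ?index_mem.
Qed.

Lemma end_attach a b : base a \in A -> new b -> great_shadow e a b ->
  [/\ base a = v, a = inl v -> [\/ tau b <= 3 | tau b = m.*2]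
    & a = inr v -> [\/ tau b = 1 | tau b = m.*2]].
Proof.
rewrite /new; case: a b => [x|x] [y|y] //= xA yq.
- move=> /(attach xA yq) [-> idx]; split=> //= _.
  by move: idx; rewrite /slot_orig -/m => -[] ->; rewrite ?eqxx /=; [left | case: eqP; [left|right]].
- have -> /= : (x == y) = false by apply: contraNF (q_out yq) => /eqP <-.
  rewrite sym => /(attach xA yq) [-> idx]; split=> //= _; left.
  by move: idx yq; rewrite /slot_shadow -index_mem -/m => -[] ->; case: eqP; lia.
- have -> /= : (x == y) = false by apply: contraNF (q_out yq) => /eqP <-.
  move=> /(attach xA yq) [-> idx]; split=> //= _.
  by move: idx; rewrite /slot_orig -/m => -[] ->; rewrite ?eqxx /=; [left | case: eqP; [left|right]].
Qed.

Lemma base_v a : base a = v -> a = l \/ a = h.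
Proof. by rewrite /l /h; case: a => x /= ->; case: ifP; auto. Qed.

Lemma lh_neq : l != h. Proof. by rewrite /l /h; case: ifP. Qed.

Lemma base_l : base l = v. Proof. by rewrite /l; case: ifP. Qed.
Lemma base_h : base h = v. Proof. by rewrite /h; case: ifP. Qed.

Lemma pos_lh : pos l < pos h.
Proof.
have [_ inj _] := lay; rewrite ltn_neqAle; apply/andP; split.
  by apply: contraNneq lh_neq => /inj ->; rewrite ?base_l ?base_h.
by rewrite /l /h; case: ltnP => //; apply: ltnW.
Qed.

Lemma edge_lh : great_shadow e l h.
Proof. by rewrite /l /h; case: ifP => _ /=; rewrite eqxx. Qed.

Lemma B_new a : base a \in B -> ~~ new a -> base a \in A.
Proof. by rewrite /B inE inE /new => /orP [|->]. Qed.

(* An edge of the ear cannot separate, on the page used by [a], its end in the ear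
   from [a]. *)
Lemma pg_end_internal a x b c : base a \in A -> new x -> great_shadow e a x ->
  new b -> new c -> great_shadow e b c -> tau b < tau x -> tau x < tau c ->
  pg_end a != pg' b c.
Proof.
move=> aA nx eax nb nc ebc bx xc.
have ge := gadget_edge_new nb nc ebc.
have [va vl vr] := end_attach aA nx eax.
have /andP [_ cK] := slot_bounds nc; have /andP [b0 _] := slot_bounds nb.
have bc : tau b < tau c by apply: ltn_trans xc.
rewrite /pg' nb nc /up.
move: ge; rewrite (minn_idPl (ltnW bc)) (maxn_idPr (ltnW bc)) => ge.
case: a va vl vr aA {eax} => z /= -> vl vr _; last first.
  by have := vr erefl; clear -b0 cK bx xc; rewrite /K; lia.
have -> : upper m (tau b) (tau c); last by case: pg_end.
by have := vl erefl; clear -b0 cK bx xc; rewrite /upper /K; lia.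
Qed.

(** The cases tell which of the four ends are new. Inside the ear, [gadget_edge_cross] applies;
    against an edge attaching the ear, [pg_end_internal] does. Attaching edges to [l] and to [h] lie
    on different pages, and against an old edge an attaching edge to [h] behaves like [l h]. *)
Lemma two_page_extend : two_page (fun a b => [&& great_shadow e a b, base a \in B & base b \in B]) pos' pg'.
Proof.
have gsym := great_shadow_sym sym.
have [[pg_sym cross] inj pair] := lay.
have lA : base l \in A by rewrite base_l. 
have hA : base h \in A by rewrite base_h.
have lh := pos_lh; have elh := edge_lh.
have endE a x : base a \in B -> new x -> ~~ new a -> great_shadow e a x -> a = l \/ a = h.
  by move=> aB nx na eax; have [/base_v] := end_attach (B_new aB na) nx eax.
have endE' a x : base a \in B -> new x -> ~~ new a -> great_shadow e x a -> a = l \/ a = h.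
  by rewrite gsym; apply: endE.
have pl : pg_end l = ~~ pg l h by rewrite /pg_end (negbTE lh_neq).
have ph : pg_end h = pg l h by rewrite /pg_end eqxx.
split.
  move=> a b; rewrite /pg'; case: (new a); case: (new b) => //.
  by rewrite /up minnC maxnC.
move=> a b c d /and3P [eab aB bB] /and3P [ecd cB dB]; rewrite !pos'_lt.
case: (boolP (new a)) => na; case: (boolP (new b)) => nb;
  case: (boolP (new c)) => nc; case: (boolP (new d)) => nd //=.

- move=> ac cb bd; rewrite /pg' na nb nc nd.
  have := gadget_edge_cross q_odd (gadget_edge_new na nb eab) (gadget_edge_new nc nd ecd).
  have ab := ltn_trans ac cb; have cd := ltn_trans cb bd; rewrite /up.
  rewrite (minn_idPl (ltnW ab)) (maxn_idPr (ltnW ab)) (minn_idPl (ltnW cd)) (maxn_idPr (ltnW cd)).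
  by move=> /(_ ac cb bd); case: upper; case: upper; case: pg_end.
- move=> ac cb ld; rewrite eq_sym {1}/pg' nc (negbTE nd).
  by apply: (@pg_end_internal d c) => //; [exact: B_new | rewrite gsym].
- by move=> lt /(leq_trans lt); rewrite ltnn.
- by move=> lt /(leq_trans lt); rewrite ltnn.
- by move=> _ lt /(leq_trans lt); rewrite ltnn.
- move=> _ lb bd; have [eb|eb] := endE' _ _ bB na nb eab; first by rewrite eb ltnn in lb.
  have [ed|ed] := endE' _ _ dB nc nd ecd; last by rewrite eb ed ltnn in bd.
  by rewrite eb ed ltnNge (ltnW lh) in bd.
- by move=> lc cb /(leq_trans (ltn_trans lc cb)); rewrite ltnn.
- move=> lc cb bd; have [eb|eb] := endE' _ _ bB na nb eab.
    by have := ltn_trans lc cb; rewrite eb ltnn.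
  rewrite /pg' na (negbTE nb) (negbTE nc) (negbTE nd) eb ph; rewrite eb in cb bd.
  by apply: cross; rewrite ?elh ?lA ?hA ?ecd ?B_new.
- move=> al cb bd; rewrite {1}/pg' nb (negbTE na).
  by apply: (@pg_end_internal a b) => //; exact: B_new.
- move=> al cb ld; have [ea|ea] := endE _ _ aB nb na eab; last by rewrite ea leqNgt lh in al.
  have [ed|ed] := endE' _ _ dB nc nd ecd; first by rewrite ed ltnn in ld.
  by rewrite /pg' (negbTE na) nb nc (negbTE nd) ea ed pl ph; case: (pg l h).
- move=> ac cl _; have al := leq_trans ac cl.
  have [ea|ea] := endE _ _ aB nb na eab; first by rewrite ea ltnn in al.
  by rewrite ea ltnNge (ltnW lh) in al.
- move=> ac cl _; have al := leq_trans ac cl.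
  have [ea|ea] := endE _ _ aB nb na eab; first by rewrite ea ltnn in al.
  by rewrite ea ltnNge (ltnW lh) in al.
- by move=> _ lt /(leq_trans lt); rewrite ltnn.
- move=> al lb bd; have [ed|ed] := endE' _ _ dB nc nd ecd.
    by have := ltn_trans lb bd; rewrite ed ltnn.
  rewrite /pg' (negbTE na) (negbTE nb) nc (negbTE nd) ed ph; rewrite ed in bd.
  have rab : [&& great_shadow e a b, base a \in A & base b \in A] by rewrite eab !B_new.
  (* If the old edge starts at [l] itself, it does not interleave with [l h]; the last clause of
     [layout] is there for this case. *)
  move: al; rewrite leq_eqVlt => /orP [/eqP /inj al|al].
    have {}al : a = l by apply: al; [exact: B_new | exact: lA].
    by rewrite al in rab lb *; apply: pair => //; rewrite base_l base_h.
  by apply: cross; rewrite ?elh ?lA ?hA.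
- move=> ac cb bl; have cl := leq_trans cb bl.
  have [ec|ec] := endE _ _ cB nd nc ecd; first by rewrite ec ltnn in cl.
  by rewrite ec ltnNge (ltnW lh) in cl.
- move=> ac cb bd; rewrite /pg' (negbTE na) (negbTE nb) (negbTE nc) (negbTE nd).
  by apply: cross; rewrite ?eab ?ecd ?B_new.
Qed.

Lemma layout_extend : layout e B pos' pg'.
Proof.
have [[pg_sym cross] inj pair] := lay.
split; first exact: two_page_extend.
- move=> a b aB bB eq.
  have := pos'_lt a b; have := pos'_lt b a; rewrite eq !ltnn.
  case: (boolP (new a)) => na; case: (boolP (new b)) => nb => lt1 lt2.
  + by apply: tau_inj => //; move: lt1 lt2; case: ltngtP.
  + by move: lt1 lt2; case: ltngtP.
  + by move: lt1 lt2; case: ltngtP.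
  + by apply: inj; rewrite ?B_new //; move: lt1 lt2; case: ltngtP.
- move=> l0 h0 d lh0 /and3P [eld l0B dB] h0B; rewrite !pos'_lt.
  have nlh : new l0 = new h0 by rewrite /new lh0.
  rewrite -nlh; case: (boolP (new l0)) => nl; case: (boolP (new d)) => nd.
  + have nh : new h0 by rewrite -nlh.
    move=> ld dh; rewrite /pg' nl nd nh.
    have lh := ltn_trans ld dh; rewrite /up.
    have ge := gadget_edge_new nl nd eld.
    move: ge; rewrite (minn_idPl (ltnW ld)) (maxn_idPr (ltnW ld)) (minn_idPl (ltnW lh)) (maxn_idPr (ltnW lh)).
    move=> ge; suff : upper m (tau l0) (tau d) != upper m (tau l0) (tau h0).
      by case: upper; case: upper; case: pg_end.
    (* A vertex of the ear and its shadow fill adjacent slots, with nothing between, except the last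
       pair, in slots 3 and 2m; from slot 3, only the edge to slot 4 ends in between. *)
    clear -q_odd lh0 nl ge ld dh lh; move: (tau d) ge ld dh lh => t; move: lh0 nl.
    rewrite /tau /new -index_mem -/m; case: l0 h0 => [x|x] [_|_] /= <-; rewrite ?ltnn //;
      rewrite /slot_orig /slot_shadow; move: (index x q) => i im.
      by do !case: eqP; lia.
    case: eqP => i0; first by lia.
    case: eqP => im1; last by lia.
    have -> : (m - i).*2.+1 = 3 by lia.
    rewrite /upper => -[|[? ? []]|[]|[]] *; lia.
  + by move=> lt /(leq_trans lt); rewrite ltnn.
  + have l0A := B_new l0B nl; have h0A : base h0 \in A by rewrite -lh0.
    move=> l0l lh0'; have [l0v _ _] := end_attach l0A nd eld.
    have h0v : base h0 = v by rewrite -lh0.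
    have [l0E|l0E] := base_v l0v; last by rewrite l0E leqNgt pos_lh in l0l.
    have [h0E|h0E] := base_v h0v; first by rewrite h0E ltnn in lh0'.
    rewrite /pg' (negbTE nl) nd -nlh (negbTE nl) l0E h0E.
    by rewrite /pg_end (negbTE lh_neq); case: (pg l h).
  + move=> ld dh; rewrite /pg' (negbTE nl) (negbTE nd) -nlh (negbTE nl).
    by apply: pair; rewrite ?B_new // ?eld /new -?lh0.
Qed.
End Extend.

(** * Growing a bipartite cactus *)

Section Growth.
Variables (T : finType) (e : rel T).
Hypotheses (sym : symmetric e) (irr : irreflexive e) (cact : cactus e).

Lemma path_iota (w : nat -> T) k m : (forall i, e (w i) (w i.+1)) ->
  path e (w k) [seq w i | i <- iota k.+1 m] /\ last (w k) [seq w i | i <- iota k.+1 m] = w (k + m).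
Proof.
move=> ew; elim: m k => [|m IH] k; first by rewrite addn0.
by have [/= -> ->] := IH k.+1; rewrite ew addnS.
Qed.

(** The arc from [w 0] to [w b] followed by [p] is a second cycle through the edge [w 0 w 1], so it
    has the same edges as the first. Its closing edge is not among them: it has an end in [p], or is
    a chord. *)
Lemma cactus_no_ear n w b p : cycle_fun e n w -> 0 < b -> b < n ->
  path e (w b) (rcons p (w 0)) -> uniq p -> (forall z i, z \in p -> z != w i) ->
  (p = [::] -> 1 < b /\ b.+1 < n) -> False.
Proof.
move=> [n2 ew wP] b0 bn pp p_uniq p_out chord.
have w_inj : {in gtn n &, injective w}.
  by move=> i j hi hj /eqP; rewrite wP !modn_small // => /eqP.
have w_per : w n = w 0 by apply/eqP; rewrite wP modnn mod0n.
pose c1 := [seq w i | i <- iota 0 n]; pose c2 := [seq w i | i <- iota 0 b.+1] ++ p.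
have nE : n = n.-1.+1 by lia.
have bE : b = b.-1.+1 by lia.
have nE2 : n.-1 = n.-2.+1 by lia.
have uniq_w k : k <= n -> uniq [seq w i | i <- iota 0 k].
  move=> kn; rewrite map_inj_in_uniq ?iota_uniq //.
  by apply: sub_in2 w_inj => i; rewrite mem_iota add0n => /leq_trans; apply.
have u1 : uniq c1 by apply: uniq_w.
have u2 : uniq c2.
  rewrite cat_uniq p_uniq uniq_w // andbT.
  by apply/hasPn => z /p_out zw; apply/mapP => -[i _ zE]; have := zw i; rewrite zE eqxx.
have s1 : size c1 = n by rewrite size_map size_iota.
have s2 : size c2 = b.+1 + size p by rewrite size_cat size_map size_iota.
have g1 : is_graph_cycle e c1.
  rewrite /is_graph_cycle s1 n2 /ucycleb u1 andbT /c1 nE /= rcons_path.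
  by have [-> ->] := path_iota 0 n.-1 ew; rewrite add0n -w_per [in w n]nE ew.
have g2 : is_graph_cycle e c2.
  rewrite /is_graph_cycle s2 /ucycleb u2 andbT; apply/andP; split.
    by case: (p) chord => [|z p'] /= => [/(_ erefl)|_]; lia.
  rewrite /c2 /= rcons_cat cat_path.
  by have [-> ->] := path_iota 0 b ew.
have e1 : [set w 0; w 1] \in cycle_edges c1.
  apply/imsetP; exists (w 0); rewrite /c1 nE nE2 /= ?eqxx //.
  by rewrite inE eqxx.
have e2 : [set w 0; w 1] \in cycle_edges c2.
  apply/imsetP; exists (w 0); rewrite /c2 bE /= ?eqxx //.
  by rewrite inE eqxx.
have eqE : cycle_edges c1 = cycle_edges c2.
  by apply: cact => //; apply/set0Pn; exists [set w 0; w 1]; rewrite inE e1.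
have n0 : 0 < n := ltnW (ltnW n2).
have c1_0 : 0 < size c1 by rewrite s1.
have c2_0 : 0 < size c2 by rewrite s2.
have : [set last (w b) p; w 0] \in cycle_edges c2.
  apply/(cycle_edges_cyc_nth (w 0) _ u2 c2_0); exists (size c2).-1.
  rewrite prednK // /cyc_nth modnn modn_small ?prednK // nth_last.
  rewrite /c2 last_cat; congr [set _; _].
  by have [_ ] := path_iota 0 b ew; rewrite /= => ->.
rewrite -eqE => /(cycle_edges_cyc_nth (w 0) _ u1 c1_0) [i].
have cycE j : cyc_nth (w 0) c1 j = w j.
  rewrite /cyc_nth s1 (nth_map 0) ?size_iota ?nth_iota ?ltn_mod //.
  by apply/eqP; rewrite wP add0n modn_mod.
rewrite !cycE => /setP eqi.
have := eqi (last (w b) p); rewrite !inE eqxx /= => /esym last_i.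
case: (p) chord p_out last_i eqi => [|z p'] chord p_out /=; last first.
  have := mem_last z p' => zp.
  by rewrite !(negbTE (p_out _ _ zp)).
have [b1 b1n] := chord erefl.
move=> bi /(_ (w 0)); rewrite !inE eqxx orbT => /esym; move: bi; rewrite !wP.
move=> /orP [] /eqP bi /orP [] /eqP i0; clear -n2 b0 bn b1 b1n bi i0.
- by move: bi; rewrite -i0 mod0n modn_small //; lia.
- have : (b + 1) %% n = 0 by rewrite -modnDml bi modnDml addn1 -i0 mod0n.
  by rewrite modn_small //; lia.
- have : b %% n = 1 by rewrite bi -addn1 -modnDml -i0 mod0n modn_small //; lia.
  by rewrite modn_small //; lia.
- by move: bi; rewrite -i0 mod0n modn_small //; lia.
Qed.

Lemma cactus_chord n w i j : cycle_fun e n w -> i < j -> j < n -> e (w i) (w j) ->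
  j = i.+1 \/ j = i + n.-1.
Proof.
move=> fw ij jn eij; have [n2 ew wP] := fw.
have [->|ji] := eqVneq j i.+1; first by left.
have [->|ji'] := eqVneq j (i + n.-1); first by right.
case: (@cactus_no_ear n (fun k => w (i + k)) (j - i) [::]) => //; try lia.
- exact: cycle_fun_shift.
- by rewrite /= addn0 subnKC ?(ltnW ij) // sym eij.
Qed.

Lemma path_rcons_rev x y p : path e x (rcons p y) -> path e y (rcons (rev p) x).
Proof.
move=> pp; rewrite -rev_cons.
have := rev_path e x (rcons p y); rewrite last_rcons belast_rcons => ->.
by rewrite (eq_path (e' := e)) // => u v; rewrite sym.
Qed.

Lemma cactus_no_outer_path n w i j p : cycle_fun e n w -> i < n -> j < n -> i != j ->
  path e (w i) (rcons p (w j)) -> uniq p -> p != [::] ->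
  (forall z k, z \in p -> z != w k) -> False.
Proof.
move=> fw; wlog ij : i j p / j < i.
  move=> main hi hj ij pp up pn pw; have [lt|le] := ltnP j i.
    exact: (main i j p).
  apply: (main j i (rev p)) => //; rewrite ?rev_uniq //.
  - by rewrite ltn_neqAle ij.
  - by rewrite eq_sym.
  - exact: path_rcons_rev.
  - by rewrite -size_eq0 size_rev size_eq0.
  - by move=> z k; rewrite mem_rev; apply: pw.
move=> hi hj _ pp up pn pw.
apply: (@cactus_no_ear n (fun k => w (j + k)) (i - j) p) => //; try lia.
- exact: cycle_fun_shift.
- by rewrite addn0 subnKC // ltnW.
- by move=> z k; apply: pw.
- by move=> p0; rewrite p0 in pn.
Qed.

Definition outside (A : {set T}) : rel T := [rel x y | [&& e x y, x \notin A & y \notin A]].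

(** The invariant of the growth: each component of the graph outside [A] is attached to [A] by at
    most one vertex. *)
Definition detached (A : {set T}) : Prop :=
  forall u v x y, u \in A -> v \in A -> x \notin A -> y \notin A ->
    connect (outside A) x y -> e u x -> e v y -> u = v.

(** * Ears of a detached set *)

Section Step.
Variables (A : {set T}) (f : T -> bool) (v x0 : T).
Hypotheses (f_col : forall x y, e x y -> f x != f y).
Hypotheses (det : detached A) (vA : v \in A) (x0A : x0 \notin A) (ex0 : e v x0).

(** A first return of the path to [A] would have to be at [v], because [A] is detached. *)
Lemma path_leaves p : path e x0 p -> v \notin p -> forall z, z \in x0 :: p -> z \notin A.
Proof.
move=> pp vp.
suff [all_out _] : all (fun z => z \notin A) (x0 :: p) /\ connect (outside A) x0 (last x0 p).
  exact/allP.
elim/last_ind: p pp vp => [|p z IH]; first by rewrite /= x0A connect0.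
rewrite rcons_path mem_rcons inE negb_or => /andP [pp ez] /andP [vz vp].
have [out conn] := IH pp vp.
have lastA : last x0 p \notin A by apply: (allP out); apply: mem_last.
have zA : z \notin A.
  apply: contraNN vz => zA; apply/eqP; apply: (det vA zA x0A lastA conn ex0).
  by rewrite sym.
rewrite -rcons_cons all_rcons zA out last_rcons; split=> //.
by apply: (connect_trans conn); apply: connect1; rewrite /outside /= ez lastA zA.
Qed.

Lemma path_outside_connect p : path e x0 p -> (forall z, z \in x0 :: p -> z \notin A) ->
  forall z, z \in x0 :: p -> connect (outside A) x0 z.
Proof.
move=> pp out z zp; apply: (path_connect (p := p)) => //.
elim: p {z zp} x0 out pp => //= y p IH x out /andP [exy pp].
rewrite {1}/outside /=.
rewrite exy !out ?inE ?eqxx ?orbT //=; apply: IH => // z zp.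
by apply: out; rewrite inE zp orbT.
Qed.

Lemma outside_sym (C : {set T}) : symmetric (outside C).
Proof. by move=> x y; rewrite /outside /= sym (andbC (x \notin C)). Qed.

Lemma path_coloring x p : path e x p -> f (last x p) = f x (+) odd (size p).
Proof.
elim: p x => [|y p IH] x /=; first by rewrite addbF.
move=> /andP [/f_col exy /IH ->].
by case: (f x) (f y) exy (odd _) => -[] // _ [].
Qed.

Lemma ear_odd q : path e v q -> e (last v q) v -> odd (size q).
Proof.
move=> /path_coloring eq /f_col; rewrite eq.
by case: (f v) (odd _) => -[].
Qed.
(** For [p] empty this is the pendant edge [v x0], otherwise a cycle through [v]. *)
Definition ear (p : seq T) : Prop :=
  [/\ path e x0 p, uniq [:: v, x0 & p] & e (last x0 p) v].

Lemma ear_out p : ear p -> forall z, z \in x0 :: p -> z \notin A.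
Proof.
move=> [pp /andP [vp _] _]; apply: path_leaves => //.
by move: vp; rewrite inE negb_or => /andP [].
Qed.

Lemma ear_cycle p : ear p -> p != [::] ->
  cycle_fun e (size p).+2 (cyc_nth v [:: v, x0 & p]).
Proof.
move=> [pp up cp] p0; apply: (@cycle_fun_cyc_nth _ _ v [:: v, x0 & p]).
rewrite /is_graph_cycle /ucycleb up andbT /= ex0 rcons_path pp cp /=.
by case: p p0 {pp up cp}.
Qed.

Lemma ear_cyc_nth p z : z \in x0 :: p ->
  z = cyc_nth v [:: v, x0 & p] (index z (x0 :: p)).+1.
Proof.
move=> zp; rewrite /cyc_nth modn_small; first by rewrite [RHS]/= nth_index.
by have := zp; rewrite -index_mem.
Qed.

Lemma ear_attach p x y : ear p -> x \in A -> y \in x0 :: p -> e x y ->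
  x = v /\ (index y (x0 :: p) = 0 \/ index y (x0 :: p) = size p).
Proof.
move=> earp xA yp exy; have [pp up cp] := earp; have out := ear_out earp.
have xv : x = v.
  apply/esym; apply: (det vA xA x0A (out y yp) _ ex0 exy).
  exact: (path_outside_connect pp out yp).
split=> //; have [p0|p0] := eqVneq p [::].
  by left; move: yp; rewrite p0 inE => /eqP ->; rewrite /= eqxx.
have := yp; rewrite -index_mem /= => ip.
have := @cactus_chord _ _ 0 (index y (x0 :: p)).+1 (ear_cycle earp p0) isT.
have -> : cyc_nth v [:: v, x0 & p] 0 = x by rewrite /cyc_nth mod0n xv.
by rewrite -ear_cyc_nth // => /(_ ip exy) [[->]|[->]]; [left|right].
Qed.

Lemma ear_consecutive p x y : ear p -> x \in x0 :: p -> y \in x0 :: p -> e x y ->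
  index y (x0 :: p) = (index x (x0 :: p)).+1 \/ index x (x0 :: p) = (index y (x0 :: p)).+1.
Proof.
move=> earp xp yp exy; have [p0|p0] := eqVneq p [::].
  by move: xp yp exy; rewrite p0 !inE => /eqP -> /eqP ->; rewrite irr.
have fw := ear_cycle earp p0; have ex := ear_cyc_nth xp; have ey := ear_cyc_nth yp.
have iy : index y (x0 :: p) < (size p).+1 by move: yp; rewrite -index_mem.
have ix : index x (x0 :: p) < (size p).+1 by move: xp; rewrite -index_mem.
rewrite {1}ex {1}ey in exy; move: (index x _) (index y _) ix iy exy => i j hi hj eij {ex ey}.
have [lt|lt|eq] := ltngtP i j; last by rewrite eq irr in eij.
- left; case: (cactus_chord fw (_ : i.+1 < j.+1) hj eij) => // [[//]|] eq.
  by clear -hj eq; lia.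
- rewrite sym in eij.
  right; case: (cactus_chord fw (_ : j.+1 < i.+1) hi eij) => // [[//]|] eq.
  by clear -hi eq; lia.
Qed.

(** A path outside the new set that joins two vertices of the cycle contradicts
    [cactus_no_outer_path]; for a pendant edge it would close into a longer ear, which [maxp]
    excludes. A vertex of [A] and one of the ear joined in this way reduce to this case, the former
    being [v] because [A] is detached. *)
Lemma detached_extend p : ear p -> (p = [::] -> forall p', p' != [::] -> ~ ear p') ->
  detached (A :|: [set z in x0 :: p]).
Proof.
move=> earp maxp; set B := A :|: _; have [pp up cp] := earp; have out := ear_out earp.
have B_A z : z \notin B -> z \notin A by rewrite !inE negb_or => /andP [].
have B_q z : z \notin B -> z \notin x0 :: p by rewrite !inE negb_or => /andP [].
have sub : subrel (outside B) (outside A).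
  by move=> x y /and3P [exy /B_A xA /B_A yA]; apply/and3P.
have mono x y : connect (outside B) x y -> connect (outside A) x y.
  by apply: connect_sub => ? ? /sub; apply: connect1.
have inside u1 u2 x y : u1 \in [:: v, x0 & p] -> u2 \in [:: v, x0 & p] ->
    x \notin B -> y \notin B -> connect (outside B) x y -> e u1 x -> e u2 y -> u1 = u2.
  move=> u1c u2c xB yB /connectP [s0 /shortenP [s ps us _] yE] e1 e2.
  apply/eqP; apply: contraT => u12; exfalso.
  have sB z : z \in x :: s -> z \notin B.
    move=> zs; elim: s x ps {us yE xB e1} zs (xB) => [|t s IH] x /= ps zs xB0.
      by move: zs; rewrite inE => /eqP ->.
    move: ps zs => /andP [/and3P [_ _ tB] ps]; rewrite inE => /orP [/eqP -> //|zs].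
    exact: IH ps zs tB.
  have pse : path e x s by apply: sub_path ps => ? ? /and3P [].
  have conn : path e u1 (rcons (x :: s) u2) by rewrite /= e1 rcons_path pse -yE sym.
  have [p0|p0] := eqVneq p [::].
    have ear_of p' : p' != [::] -> uniq p' -> (forall z, z \in p' -> z \notin B) ->
        path e x0 (rcons p' v) -> False.
      move=> p'0 up' p'B pp'; apply: (maxp p0 p') => //; rewrite /ear.
      move: pp'; rewrite rcons_path => /andP [pp' lp']; split=> //.
      have vx0 : v != x0 by apply: contraNneq x0A => <-.
      rewrite /= inE negb_or vx0 up' andbT; apply/andP; split.
        by apply/negP => /p'B /B_A; rewrite vA.
      by apply/negP => /p'B /B_q; rewrite inE eqxx.
    move: u1c u2c u12 conn; rewrite p0 !inE => /orP [] /eqP -> /orP [] /eqP -> //;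
      rewrite ?eqxx // => _ conn.
    - apply: (ear_of (rev (x :: s))).
      + by rewrite -size_eq0 size_rev.
      + by rewrite rev_uniq.
      + by move=> z; rewrite mem_rev; apply: sB.
      + exact: path_rcons_rev.
    - exact: (ear_of (x :: s)).
  have fw := ear_cycle earp p0; have c0 : 0 < size [:: v, x0 & p] by [].
  have idx u : u \in [:: v, x0 & p] -> exists2 i, i < (size p).+2 & u = cyc_nth v [:: v, x0 & p] i.
    move=> /(nthP v) [i ic <-]; exists i => //.
    by rewrite /cyc_nth modn_small.
  have [i hi iE] := idx _ u1c; have [j hj jE] := idx _ u2c.
  apply: (@cactus_no_outer_path _ _ i j (x :: s) fw) => //.
  - by apply: contraNneq u12 => ij; rewrite iE jE ij.
  - by rewrite -iE -jE.
  - move=> z k /sB zB; apply: contraNneq zB => ->.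
    have : cyc_nth v [:: v, x0 & p] k \in [:: v, x0 & p] by rewrite mem_nth // ltn_mod.
    by rewrite inE => /orP [/eqP ->|kp]; rewrite /B !inE ?vA // -in_cons kp orbT.
have attached u1 u2 x y : u1 \in A -> u2 \in x0 :: p -> x \notin B -> y \notin B ->
    connect (outside B) x y -> e u1 x -> e u2 y -> u1 = u2.
  move=> u1A u2q xB yB conn e1 e2.
  have u1v : u1 = v.
    apply: (det u1A vA (B_A _ xB) x0A _ e1 ex0).
    apply: (connect_trans (mono _ _ conn)).
    apply: (@connect_trans _ _ u2).
      by apply: connect1; rewrite /outside /= sym e2 B_A // out.
    rewrite (sym_connect_sym (@outside_sym A)).
    exact: (path_outside_connect pp out u2q).
  by apply: inside conn e1 e2 => //; rewrite ?u1v ?mem_head // inE u2q orbT.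
move=> u1 u2 x y u1B u2B xB yB conn e1 e2; move: u1B u2B.
rewrite !in_setU ![_ \in [set z in _]]inE => /orP [u1A|u1q] /orP [u2A|u2q].
- by apply: (det u1A u2A (B_A _ xB) (B_A _ yB)) => //; apply: mono.
- exact: attached conn e1 e2.
- apply/esym; apply: attached e2 e1 => //.
  by rewrite (sym_connect_sym (@outside_sym B)).
- by apply: inside conn e1 e2 => //; rewrite inE ?u1q ?u2q orbT.
Qed.
End Step.

Lemma grow_layout (A : {set T}) (pos : T + T -> nat) (pg : rel (T + T)) (a : T) :
  connected_graph e -> bipartite e -> a \in A -> detached A -> layout e A pos pg ->
  planar (great_shadow e).
Proof.
move=> conn [f f_col]; have [n] := ubnP #|~: A|.
elim: n => // n IH in A pos pg *; rewrite ltnS => An aA det lay.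
have [[v x0] /= /and3P [vA x0A ex0]|closedA] :=
    pickP (fun p : T * T => [&& p.1 \in A, p.2 \notin A & e p.1 p.2]); last first.
  have allA x : x \in A.
    have /connectP [p pp ->] := conn a x; elim: p (a) aA pp => //= y p IHp b bA /andP [eby].
    by apply: IHp; have := closedA (b, y); rewrite /= bA eby andbT => /negbFE.
  have [[pg_sym cross] inj _] := lay.
  apply: (two_page_planar (pos := pos) (pg := pg)).
  - by move=> [x|x] /=; rewrite ?irr.
  - exact: great_shadow_sym.
  - by move=> x y; apply: inj.
  - split=> // b c d g ebc edg; apply: cross; by rewrite ?ebc ?edg !allA.
(* A cycle is preferred to a pendant edge, as [detached_extend] demands. *)
have [p [earp maxp]] : exists p, ear v x0 p /\
    (p = [::] -> forall p', p' != [::] -> ~ ear v x0 p').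
  have [[p [p0 earp]]|none] :=
    Classical_Prop.classic (exists p, p != [::] /\ ear v x0 p).
    by exists p; split=> // pn; rewrite pn in p0.
  exists [::]; split; last by move=> _ p' p'0 earp'; apply: none; exists p'.
  split=> //; last by rewrite /= sym.
  by rewrite /= inE andbT; apply: contraNneq x0A => <-.
have [pp up cp] := earp; have out := ear_out det vA x0A ex0 earp.
have q_odd : odd (size (x0 :: p)) by apply: (ear_odd f_col (v := v)) => //=; rewrite ex0.
have det' := detached_extend det vA x0A ex0 earp maxp.
have uq : uniq (x0 :: p) by case/andP: up.
have lay' := layout_extend sym lay vA uq q_odd out
  (fun x y xA yp exy => ear_attach det vA x0A ex0 earp xA yp exy)
  (fun x y xp yp exy => ear_consecutive ex0 earp xp yp exy).
apply: (IH _ _ _ _ _ det' lay'); last by rewrite inE aA.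
apply: leq_trans An; apply: proper_card; apply/properP; split.
  by rewrite setCS subsetUl.
by exists x0; rewrite !inE ?eqxx ?x0A // orbT.
Qed.

Lemma bipartite_cactus_planar : connected_graph e -> bipartite e -> planar (great_shadow e).
Proof.
move=> conn bip; have [a _|T0] := pickP (mem T); last first.
  exists (fun _ => (0, 0)%Re), (fun _ _ _ => (0, 0)%Re).
  by split=> [[x|x]|]; [have := T0 x|have := T0 x|split=> [[x|x]|[x|x]]; have := T0 x].
(* Only [a] and its shadow are compared in the initial layout, so two positions suffice. *)
pose pos (b : T + T) := if b is inl _ then 0 else 1.
apply: (@grow_layout [set a] pos (fun _ _ => true) a) => //.
- by rewrite inE.
- by move=> u v x y; rewrite !inE => /eqP -> /eqP ->.
- split.
  + split=> // b c d g _ _; rewrite /pos.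
    by case: b; case: c; case: d; case: g.
  + by move=> [x|x] [y|y]; rewrite /= !inE => /eqP -> /eqP ->.
  + by move=> [x|x] [y|y] [z|z].
Qed.
End Growth.

Theorem theorem1p1 (T : finType) (e : rel T) :
  simple_graph e -> connected_graph e ->
  (planar (great_shadow e) <-> (cactus e /\ bipartite e)).
Proof.
move=> [sym irr] conn; split=> [pl|[cact bip]].
  by split; [apply: planar_cactus | apply: planar_bipartite].
exact: bipartite_cactus_planar.
Qed.
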